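(* Let $D$ be a directed set. Fix an ordinal $\xi$, a natural number $n$, and collections $\mathcal{F}_1,\ldots,\mathcal{F}_n$ of bounded functions from $\Pi\Omega_\xi$ into $\mathbb{R}$. Suppose that $\varepsilon_1,\ldots,\varepsilon_n\in\mathbb{R}$ are such that for each $1\leqslant i\leqslant n$, no member of $\mathcal{F}_i$ is $\varepsilon_i$-large. Then for any $f_1\in\mathcal{F}_1,\ldots,f_n\in\mathcal{F}_n$, $$\inf_{t\in MAX(\Omega_\xi)}\ \max_{1\leqslant i\leqslant n}\Bigl[\sum_{s\preceq t}\mathbb{P}_\xi(s)f_i(s,t)-\varepsilon_i\Bigr]\leqslant0.$$
   Context: Sequences are finite; $s\prec t$ ($s\preceq t$) means $s$ is a proper (not necessarily proper) initial segment of $t$; $s^\frown t$ is concatenation; $MAX(S)$ is the set of $\preceq$-maximal members of $S$; $\Pi S=\{(s,t)\in S\times S:s\preceq t\in MAX(S)\}$. For an ordinal $\zeta$ and a sequence of ordinals, $\zeta+(\zeta_i)_{i=1}^n=(\zeta+\zeta_i)_{i=1}^n$; $\zeta+S=\{\zeta+s:s\in S\}$. $\Gamma_0=\{(0)\}$; given $\Gamma_\xi$, $\Gamma_{\xi,1}=\Gamma_\xi$, $\Gamma_{\xi,n+1}=(\omega^\xi n+\Gamma_\xi)\cup\{t^\frown u:t\in MAX(\omega^\xi n+\Gamma_\xi),u\in\Gamma_{\xi,n}\}$, $\Gamma_{\xi+1}=\bigcup_{n\ge1}\Gamma_{\xi,n}$ (a disjoint union); for limit $\xi$, $\Gamma_\xi=\bigcup_{\zeta<\xi}(\omega^\zeta+\Gamma_{\zeta+1})$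 (a disjoint union). For a set $S$ of sequences, $SD=\{((\zeta_i,U_i))_{i=1}^n:(\zeta_i)_{i=1}^n\in S,\ U_i\in D\}$, identified with pairs $(s,\sigma)$, $s\in S$, $\sigma$ a sequence in $D$ of the same length. $\Omega_\xi=\Gamma_\xi D$, $\Omega_{\xi,n}=\Gamma_{\xi,n}D$. Each $t\in\Omega_{\xi,n}$ is uniquely $((\omega^\xi(n-1)+t_1)^\frown\cdots^\frown(\omega^\xi(n-m)+t_m),\sigma)$ with $1\leqslant m\leqslant n$, $t_i\in\Gamma_\xi$, $t_i\in MAX(\Gamma_\xi)$ for $i<m$; put $\iota_{\xi,n}(t)=(t_m,\sigma_m)\in\Omega_\xi$, where $\sigma_m$ consists of the last $|t_m|$ terms of $\sigma$. $\mathbb{P}_\xi:\Omega_\xi\to[0,1]$: $\mathbb{P}_0((0,U))=1$; $\mathbb{P}_{\xi+1}(t)=\frac1n\mathbb{P}_\xi(\iota_{\xi,n}(t))$ for $t\in\Omega_{\xi,n}$; for limit $\xi$, $\mathbb{P}_\xi((\omega^\zeta+t',\sigma))=\mathbb{P}_{\zeta+1}((t',\sigma))$ for $\zeta<\xi$, $t'\in\Gamma_{\zeta+1}$. A map $\theta:\Omega_\xi\to\Omega_\xi$ is a pruning if $s\prec t$ implies $\theta(s)\prec\theta(t)$, and whenever $s$ has last term $(\zeta,U)$ and $\theta(s)$ has last term $(\zeta',U')$, $U\leqslant_DU'$. If moreover $e:MAX(\Omega_\xi)\to MAX(\Omega_\xi)$ satisfies $\theta(t)\preceq e(t)$ for all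 $t\in MAX(\Omega_\xi)$, then $(\theta,e):\Omega_\xi\to\Omega_\xi$ is an extended pruning. A bounded $f:\Pi\Omega_\xi\to\mathbb{R}$ is $\varepsilon$-large ($\varepsilon\in\mathbb{R}$) if for any $\delta>0$ there is an extended pruning $(\theta,e):\Omega_\xi\to\Omega_\xi$ with $f(\theta(s),e(t))\geqslant\varepsilon-\delta$ for every $(s,t)\in\Pi\Omega_\xi$. *)

(* Defs.v *)
From HB Require Import structures.
From mathcomp Require Import all_boot all_order all_algebra.
From mathcomp Require Import all_classical all_reals all_analysis.

Set Implicit Arguments.
Unset Strict Implicit.
Unset Printing Implicit Defensive.

Import Order.TTheory GRing.Theory Num.Theory.
Import numFieldNormedType.Exports.

Local Open Scope quotient_scope.
Local Open Scope classical_set_scope.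
Local Open Scope order_scope.

(* [ONode f] represents the least ordinal strictly above every [f a]; two trees
   represent the same ordinal when each is [tle] the other. *)
Inductive otree : Type := ONode (A : Type) (f : A -> otree).

Fixpoint tle (s t : otree) : Prop :=
  match s, t with
  | ONode A f, ONode B g => forall a, exists b, tle (f a) (g b)
  end.

Definition tlt (s t : otree) : Prop :=
  match t with ONode B g => exists b, tle s (g b) end.

Lemma tle_node A (f : A -> otree) t : tle (ONode f) t <-> forall a, tlt (f a) t.
Proof. by case: t => B g; split=> H a; exact: (H a). Qed.

Lemma tle_refl t : tle t t.
Proof. by elim: t => A f IH a; exists a; exact: IH. Qed.

Lemma tle_trans s t u : tle s t -> tle t u -> tle s u.
Proof.
elim: s t u => A f IH [B g] [C h] st tu a.
have [b fg] := st a; have [c gh] := tu b; exists c; exact: IH fg gh.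
Qed.

Lemma tle_lt_trans s t u : tle s t -> tlt t u -> tlt s u.
Proof. by case: u => C h st [c tc]; exists c; exact: tle_trans tc. Qed.

Lemma tlt_le_trans s t u : tlt s t -> tle t u -> tlt s u.
Proof.
by case: t u => B g [C h] [b sb] tu; have [c bc] := tu b; exists c; exact: tle_trans bc.
Qed.

Lemma tlt_le s t : tlt s t -> tle s t.
Proof.
elim: s t => A f IH [B g] [b sb] a; exists b; apply: IH.
by move/tle_node: sb; apply.
Qed.

Lemma tltNge s t : tlt s t <-> ~ tle t s.
Proof.
split; first by elim: s t => A f IH [B g] [b sb] /(_ b) [a ga];
  apply: (IH a (g b)) => //; move/tle_node: sb; apply.
elim: s t => A f IH [B g] nle; apply: contrapT => nlt; apply: nle => b.
apply: contrapT => nb; apply: nlt; exists b; apply/tle_node => a.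
by apply: IH => ga; apply: nb; exists a.
Qed.

HB.instance Definition _ := gen_eqMixin otree.
HB.instance Definition _ := gen_choiceMixin otree.

Definition teq : rel otree := fun s t => `[< tle s t /\ tle t s >].

Lemma teq_refl : reflexive teq.
Proof. by move=> t; apply/asboolP; split; exact: tle_refl. Qed.

Lemma teq_sym : symmetric teq.
Proof. by move=> s t; apply/asboolP/asboolP => -[]. Qed.

Lemma teq_trans : transitive teq.
Proof.
move=> t s u /asboolP[st ts] /asboolP[tu ut].
by apply/asboolP; split; [exact: tle_trans tu|exact: tle_trans ts].
Qed.

Canonical teq_equiv := EquivRel teq teq_refl teq_sym teq_trans.

Definition ordnum : Type := {eq_quot teq}.
HB.instance Definition _ := Choice.on ordnum.

Definition oclass (t : otree) : ordnum := \pi_({eq_quot teq})%qT t.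
Definition otree_of (x : ordnum) : otree := repr (x : {eq_quot teq}).

Lemma otree_ofK x : oclass (otree_of x) = x.
Proof. exact: reprK. Qed.

Lemma oclassK t : tle (otree_of (oclass t)) t /\ tle t (otree_of (oclass t)).
Proof.
apply/asboolP; change (teq (otree_of (oclass t)) t); apply/eqquotP.
exact: reprK.
Qed.

Definition ole : rel ordnum := fun x y => `[< tle (otree_of x) (otree_of y) >].

Lemma ole_refl : reflexive ole.
Proof. by move=> x; apply/asboolP; exact: tle_refl. Qed.

Lemma ole_anti : antisymmetric ole.
Proof.
move=> x y /andP[/asboolP xy /asboolP yx].
rewrite -(otree_ofK x) -(otree_ofK y); apply/eqquotP; exact/asboolP.
Qed.

Lemma ole_trans : transitive ole.
Proof.
by move=> y x z /asboolP xy /asboolP yz; apply/asboolP; exact: tle_trans yz.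
Qed.

Lemma ole_total : total ole.
Proof.
move=> x y; apply/orP; case: (EM (tle (otree_of x) (otree_of y))) => [|/tltNge] xy.
  by left; apply/asboolP.
by right; apply/asboolP; exact: tlt_le.
Qed.

Fact ordnum_display : Order.disp_t. Proof. exact: Order.Disp tt tt. Qed.

HB.instance Definition _ :=
  Order.Le_isPOrder.Build ordnum_display ordnum ole_refl ole_anti ole_trans.
HB.instance Definition _ :=
  Order.POrder_isTotal.Build ordnum_display ordnum ole_total.

Lemma oleE (x y : ordnum) : (x <= y) <-> tle (otree_of x) (otree_of y).
Proof. by split=> /asboolP. Qed.

Lemma oltE (x y : ordnum) : (x < y) <-> tlt (otree_of x) (otree_of y).
Proof.
rewrite ltNge; split.
  by move=> /negP yx; apply/tltNge => /oleE.
by move=> /tltNge yx; apply/negP => /oleE.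
Qed.

Lemma oclass_le s t : (oclass s <= oclass t) <-> tle s t.
Proof.
have [s1 s2] := oclassK s; have [t1 t2] := oclassK t.
split=> [/oleE st|st]; first exact: tle_trans (tle_trans s2 st) t1.
by apply/oleE; exact: tle_trans (tle_trans s1 st) t2.
Qed.

Lemma oclass_lt s t : (oclass s < oclass t) <-> tlt s t.
Proof.
rewrite ltNge; split.
  by move=> /negP ts; apply/tltNge => /oclass_le.
by move=> /tltNge ts; apply/negP => /oclass_le.
Qed.

Lemma olt_wf : well_founded (fun x y : ordnum => x < y).
Proof.
suff acc t x : tle (otree_of x) t -> Acc (fun x y : ordnum => x < y) x.
  by move=> x; exact: acc (tle_refl _).
elim: t x => B g IH x xt; constructor => y /oltE yx.
by have [b /IH] := tlt_le_trans yx xt.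
Qed.

Definition tzero : otree := ONode (fun e : void => match e with end).
Definition tsucc (t : otree) : otree := ONode (fun _ : unit => t).

(* s + t is the least ordinal above every r < s and every s + r with r < t. *)
Fixpoint tadd (s t : otree) : otree :=
  match s, t with
  | ONode A f, ONode B g =>
      ONode (fun c : A + B =>
               match c with inl a => f a | inr b => tadd s (g b) end)
  end.

Definition tmuln (t : otree) (n : nat) : otree := iter n (fun r => tadd r t) tzero.

(* omega ^ t is the least ordinal above 0 and every omega ^ r * n with r < t. *)
Fixpoint topow (t : otree) : otree :=
  match t with
  | ONode A f =>
      ONode (fun c : option (A * nat) =>
               match c with
               | None => tzero
               | Some (a, n) => tmuln (topow (f a)) n
               end)
  end.

Definition ozero : ordnum := oclass tzero.
Definition osucc (x : ordnum) : ordnum := oclass (tsucc (otree_of x)).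
Definition oadd (x y : ordnum) : ordnum := oclass (tadd (otree_of x) (otree_of y)).
Definition omuln (x : ordnum) (n : nat) : ordnum :=
  iter n (fun z => oadd z x) ozero.
Definition opow (x : ordnum) : ordnum := oclass (topow (otree_of x)).
Definition olimit (x : ordnum) : Prop :=
  ozero < x /\ forall y : ordnum, y < x -> osucc y < x.

Lemma tadd_le s s' t t' : tle s s' -> tle t t' -> tle (tadd s t) (tadd s' t').
Proof.
case: s s' => A f [A' f'] ss'; elim: t t' => B g IH [B' g'] tt' [a|b].
  by have [a' ff'] := ss' a; exists (inl a').
by have [b' gg'] := tt' b; exists (inr b'); exact: IH gg'.
Qed.

Lemma tmuln_le s t n : tle s t -> tle (tmuln s n) (tmuln t n).
Proof. by move=> st; elim: n => [|n IH] //=; exact: tadd_le. Qed.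

Lemma topow_le s t : tle s t -> tle (topow s) (topow t).
Proof.
elim: s t => A f IH [B g] st [[a n]|]; last by exists None; case.
have [b fg] := st a; exists (Some (b, n)); apply: tmuln_le; exact: IH fg.
Qed.

Lemma ozero_le x : ozero <= x.
Proof. by rewrite -(otree_ofK x); apply/oclass_le; case: (otree_of x) => B g []. Qed.

Lemma lt_osucc x y : (y < osucc x) <-> (y <= x).
Proof.
rewrite -{1}(otree_ofK y); split.
  by move=> /oclass_lt [_ yx]; apply/oleE.
by move=> /oleE yx; apply/oclass_lt; exists tt.
Qed.

Lemma lt_oadd x y z :
  (z < oadd x y) <-> z < x \/ exists2 y' : ordnum, y' < y & z <= oadd x y'.
Proof.
rewrite -{1}(otree_ofK z); split.
  move=> /oclass_lt; rewrite /oadd.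
  case Ex: (otree_of x) => [A f]; case Ey: (otree_of y) => [B g] [[a|b] zc].
    by left; apply/oltE; rewrite Ex; exists a.
  right; exists (oclass (g b)).
    by rewrite -(otree_ofK y); apply/oclass_lt; rewrite Ey; exists b; exact: tle_refl.
  rewrite -(otree_ofK z); apply/oclass_le; apply: tle_trans zc _; rewrite -Ex.
  by apply: tadd_le; [exact: tle_refl|have [] := oclassK (g b)].
move=> H; apply/oclass_lt.
case: H => [/oltE|[y' /oltE]].
  case: (otree_of x) => A f; case: (otree_of y) => B g [a za].
  by exists (inl a).
rewrite -(otree_ofK z) => yy /oclass_le zy; have [_ zK] := oclassK (otree_of z).
move: yy; rewrite otree_ofK; case Ey: (otree_of y) => [B g] [b yb].
case Ex: (otree_of x) zy => [A f] zy; exists (inr b).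
apply: tle_trans zy _; apply: tadd_le => //; exact: tle_refl.
Qed.

Lemma oclass_muln t n : oclass (tmuln t n) = omuln (oclass t) n.
Proof.
elim: n => //= n <-; apply: le_anti; apply/andP.
have [n1 n2] := oclassK (tmuln t n); have [t1 t2] := oclassK t.
by split; apply/oclass_le; exact: tadd_le.
Qed.

Lemma lt_opow y z :
  (z < opow y) <->
  z = ozero \/ exists y' n, y' < y /\ z <= omuln (opow y') n.
Proof.
rewrite -{1 2}(otree_ofK z); split.
  move=> /oclass_lt; case Ey: (otree_of y) => [B g] [[[b n]|] zc]; last first.
    by left; apply: le_anti; rewrite ozero_le andbT; apply/oclass_le.
  right; exists (oclass (g b)), n; split.
    by rewrite -(otree_ofK y); apply/oclass_lt; rewrite Ey; exists b; exact: tle_refl.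
  rewrite /opow -oclass_muln -(otree_ofK z); apply/oclass_le.
  apply: tle_trans zc _; apply: tmuln_le; apply: topow_le.
  by have [] := oclassK (g b).
move=> H; apply/oclass_lt; case: H => [z0|[y' [n [/oltE yy]]]].
  case: (otree_of y) => B g; exists None.
  by apply/oclass_le; rewrite z0.
rewrite /opow -oclass_muln -{1}(otree_ofK z) => /oclass_le zy.
move: yy; case: (otree_of y) => B g [b yb]; exists (Some (b, n)).
apply: tle_trans zy _; apply: tmuln_le; exact: topow_le.
Qed.

Local Notation "s `-< t" := (prefix s t && (s != t)) (at level 70).

Definition MAX (T : eqType) (S : set (seq T)) : set (seq T) :=
  [set s | S s /\ forall t, S t -> prefix s t -> t = s].

Definition PiS (T : eqType) (S : set (seq T)) : set (seq T * seq T) :=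
  [set p | [/\ S p.1, S p.2, prefix p.1 p.2 & MAX S p.2]].

Definition oshift (z : ordnum) (s : seq ordnum) : seq ordnum :=
  [seq oadd z x | x <- s].

(* The set Gamma_{xi,n} built from w = omega ^ xi and G = Gamma_xi; only n >= 1
   is meaningful. *)
Fixpoint GammaN_of (w : ordnum) (G : set (seq ordnum)) (n : nat) :
    set (seq ordnum) :=
  match n with
  | 0 => set0
  | 1 => G
  | n'.+1 =>
      (oshift (omuln w n') @` G) `|`
      [set s | exists t u, [/\ MAX (oshift (omuln w n') @` G) t,
                               GammaN_of w G n' u & s = t ++ u]]
  end.

Definition Gamma_step (xi : ordnum)
    (rec : forall zeta : ordnum, zeta < xi -> set (seq ordnum)) :
    set (seq ordnum) :=
  [set s |
    [\/ xi = ozero /\ s = [:: ozero],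
        exists zeta (h : zeta < xi), xi = osucc zeta /\
          exists2 n, (1 <= n)%N & GammaN_of (opow zeta) (rec zeta h) n s
      | olimit xi /\ exists zeta (h : osucc zeta < xi),
          (oshift (opow zeta) @` rec (osucc zeta) h) s]].

Definition Gamma : ordnum -> set (seq ordnum) :=
  Fix olt_wf (fun _ => set (seq ordnum)) Gamma_step.

Definition GammaN (xi : ordnum) (n : nat) : set (seq ordnum) :=
  GammaN_of (opow xi) (Gamma xi) n.

Lemma GammaE xi : Gamma xi = Gamma_step (fun zeta (_ : zeta < xi) => Gamma zeta).
Proof.
rewrite /Gamma Fix_eq // => x f g fg; congr Gamma_step.
by apply: functional_extensionality_dep => y; apply: functional_extensionality_dep.
Qed.

Lemma lt_self_osucc x : x < osucc x.
Proof. exact/lt_osucc. Qed.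

Lemma osucc_inj : injective osucc.
Proof.
move=> x y xy; apply: le_anti; apply/andP; split; apply/lt_osucc.
  by rewrite -xy; exact: lt_self_osucc.
by rewrite xy; exact: lt_self_osucc.
Qed.

Lemma osucc_neq0 x : osucc x <> ozero.
Proof. by move=> x0; have := lt_self_osucc x; rewrite x0 ltNge ozero_le. Qed.

Lemma olimit_neq_osucc x : ~ olimit (osucc x).
Proof. by case=> _ /(_ x (lt_self_osucc x)); rewrite ltxx. Qed.

Lemma Gamma0 : Gamma ozero = [set [:: ozero]].
Proof.
rewrite GammaE; apply/seteqP; split => [s [[]|[z [h]]|[[]]]|s ->].
- by [].
- by move: h; rewrite ltNge ozero_le.
- by rewrite ltxx.
by apply: Or31.
Qed.

Lemma GammaS xi : Gamma (osucc xi) = \bigcup_(n in [set n | (1 <= n)%N]) GammaN xi n.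
Proof.
rewrite GammaE; apply/seteqP; split => [s [[/osucc_neq0]|[z [h [/osucc_inj <-]]]|[/olimit_neq_osucc]]|s] //.
by case=> n n1 sn; apply: Or32; exists xi, (lt_self_osucc xi); split => //; exists n.
Qed.

Lemma Gamma_lim xi : olimit xi ->
  Gamma xi =
  \bigcup_(zeta in [set z : ordnum | z < xi]) (oshift (opow zeta) @` Gamma (osucc zeta)).
Proof.
move=> xil; rewrite GammaE; apply/seteqP; split => [s [[xi0]|[z [h [xiS]]]|[_ [z [h]]]]|s].
- by case: xil; rewrite xi0 ltxx.
- by move: xil; rewrite xiS => /olimit_neq_osucc.
- by exists z => //=; exact: lt_trans (lt_self_osucc z) h.
case=> z zx sz; apply: Or33; split=> //.
by case: xil => _ xil; exists z, (xil z zx).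
Qed.

(* SD: a sequence ((zeta_i, U_i))_i belongs to SD iff (zeta_i)_i belongs to S. *)
Definition labelled (S : set (seq ordnum)) (D : Type) : set (seq (ordnum * D)) :=
  [set t | S (unzip1 t)].
Arguments labelled : clear implicits.

Definition Omega (D : Type) (xi : ordnum) : set (seq (ordnum * D)) :=
  labelled (Gamma xi) D.
Arguments Omega : clear implicits.

Definition OmegaN (D : Type) (xi : ordnum) (n : nat) : set (seq (ordnum * D)) :=
  labelled (GammaN xi n) D.
Arguments OmegaN : clear implicits.

(* [ts] is t_1, ..., t_m; the term of index [i] below is t_(i+1). *)
Definition is_iota (D : Type) (xi : ordnum) (n : nat) (t r : seq (ordnum * D)) : Prop :=
  exists ts : seq (seq ordnum), let m := size ts in
  [/\ (1 <= m <= n)%N,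
      forall i, (i < m)%N -> Gamma xi (nth [::] ts i),
      forall i, (i < m.-1)%N -> MAX (Gamma xi) (nth [::] ts i),
      unzip1 t =
        flatten [seq oshift (omuln (opow xi) (n - i.+1)) (nth [::] ts i) | i <- iota 0 m]
    & r = zip (last [::] ts) (drop (size t - size (last [::] ts)) (unzip2 t))].

(* Graph of P_xi on Omega_xi; [Pxi] is the corresponding function, 0 off Omega_xi. *)
Inductive is_Pxi (R : realType) (D : Type) :
    ordnum -> seq (ordnum * D) -> R -> Prop :=
| is_Pxi0 (U : D) : is_Pxi ozero [:: (ozero, U)] 1%R
| is_PxiS xi n t r p : (1 <= n)%N -> OmegaN D xi n t -> is_iota xi n t r ->
    is_Pxi xi r p -> is_Pxi (osucc xi) t (n%:R^-1 * p)%R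
| is_Pxi_lim xi zeta t p : olimit xi -> zeta < xi -> Omega D (osucc zeta) t ->
    is_Pxi (osucc zeta) t p ->
    is_Pxi xi [seq (oadd (opow zeta) x.1, x.2) | x <- t] p.

Definition Pxi (R : realType) (D : Type) (xi : ordnum) (t : seq (ordnum * D)) : R :=
  xget 0%R [set p : R | is_Pxi xi t p].
Arguments Pxi R {D} xi t.

Definition directed (d : Order.disp_t) (D : preorderType d) : Prop :=
  inhabited D /\ forall U V : D, exists W : D, U <= W /\ V <= W.

(* Maps on Omega_xi, MAX(Omega_xi) and Pi Omega_xi are total functions on (pairs of)
   sequences; only their values on these sets are ever used. *)
Section Prunings.
Context (d : Order.disp_t) (D : preorderType d) (xi : ordnum).
Implicit Types theta e : seq (ordnum * D) -> seq (ordnum * D).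

Definition pruning theta : Prop :=
  [/\ forall s, Omega D xi s -> Omega D xi (theta s),
      forall s t, Omega D xi s -> Omega D xi t -> s `-< t -> theta s `-< theta t
    & forall s s1 s2 zeta U zeta' U', Omega D xi s ->
        s = rcons s1 (zeta, U) -> theta s = rcons s2 (zeta', U') -> U <= U'].

Definition extended_pruning theta e : Prop :=
  [/\ pruning theta,
      forall t, MAX (Omega D xi) t -> MAX (Omega D xi) (e t)
    & forall t, MAX (Omega D xi) t -> prefix (theta t) (e t)].

Definition large (R : realType) (f : seq (ordnum * D) * seq (ordnum * D) -> R)
    (eps : R) : Prop :=
  forall delta : R, (0 < delta)%R ->
    exists theta e, extended_pruning theta e /\
      forall s t, PiS (Omega D xi) (s, t) -> (f (theta s, e t) >= eps - delta)%R.

End Prunings.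

Definition initsegs (T : Type) (t : seq T) : seq (seq T) :=
  [seq take k t | k <- iota 0 (size t).+1].

(* Main.v *)
Require Import Defs.
From mathcomp Require Import all_boot all_order all_algebra.
From mathcomp Require Import all_classical all_reals all_analysis.
From mathcomp Require Import lra.

Set Implicit Arguments.
Unset Strict Implicit.
Unset Printing Implicit Defensive.

Import Order.TTheory GRing.Theory Num.Theory.
Import numFieldNormedType.Exports.

Local Open Scope classical_set_scope.
Local Open Scope ring_scope.

(* A stronger assertion is proved by induction on xi: if every maximal branch t of
   Omega_xi carries a colour from a finite set and values on its initial segments with
   nonnegative P_xi-average, then for every delta > 0 there are a colour c and an
   extended pruning (theta, e) such that e(t) always has colour c and its values at the
   segments theta(s), s below t, are at least - delta.  In the theorem the colour of t is
   an index i whose bracket is nonnegative.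
   At a successor, consider Omega_{xi,m} for m large.  The values being bounded, many of
   the m blocks of a branch have an almost nonnegative average of their own; which ones is
   finite information, so it can be added to the colour.  Once the first block of a branch
   is fixed, the colour and the rounded values on that block are a finite colouring of
   the continuations; pruning these makes both depend on the first block only, to
   which the induction hypothesis applies. *)

(** * Ordinals and trees of sequences *)

Section OrdinalArithmetic.
Local Open Scope order_scope.
Implicit Types x y z w : ordnum.

Lemma osucc_le x y : x < y -> osucc x <= y.
Proof. by move=> xy; rewrite leNgt; apply/negP => /lt_osucc; rewrite leNgt xy. Qed.

Lemma ord_case x : [\/ x = ozero, exists y, x = osucc y | olimit x].
Proof.
have [->|x0] := eqVneq x ozero; first exact: Or31.
have {}x0 : ozero < x by rewrite lt_neqAle eq_sym x0 ozero_le.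
have [[y yx]|nx] := pselect (exists y, x = osucc y); first by apply: Or32; exists y.
apply: Or33; split=> // y yx; rewrite lt_neqAle osucc_le // andbT.
by apply/eqP => yE; apply: nx; exists y.
Qed.

Lemma ltr_oadd z x y : x < y -> oadd z x < oadd z y.
Proof. by move=> xy; apply/lt_oadd; right; exists x. Qed.

Lemma oadd_inj z : injective (oadd z).
Proof.
by move=> x y xy; case: (ltgtP x y) => // /(ltr_oadd z); rewrite xy ltxx.
Qed.

Lemma le_oaddr z x : z <= oadd z x.
Proof.
rewrite leNgt; apply/negP => zx.
by have : oadd z x < oadd z x by [apply/lt_oadd; left]; rewrite ltxx.
Qed.

Lemma oadd0x y : oadd ozero y = y.
Proof.
elim/(well_founded_ind olt_wf): y => y IH; apply: le_anti; apply/andP; split.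
  rewrite leNgt; apply/negP => /lt_oadd [|[z zy]]; first by rewrite ltNge ozero_le.
  by rewrite IH // leNgt zy.
rewrite leNgt; apply/negP => yy.
have : oadd ozero y < oadd ozero y by apply/lt_oadd; right; exists (oadd ozero y); rewrite ?(IH _ yy).
by rewrite ltxx.
Qed.

Lemma le_oadd x x' y : x <= x' -> oadd x y <= oadd x' y.
Proof. by move=> /oleE xx; apply/oclass_le; apply: tadd_le => //; exact: tle_refl. Qed.

(** This half of associativity serves to move a copy of [w] past [omuln w n] to the right end. *)
Lemma oadd_assoc_le x y z : oadd x (oadd y z) <= oadd (oadd x y) z.
Proof.
elim/(well_founded_ind olt_wf): z => z IH.
rewrite leNgt; apply/negP => lt.
suff : oadd (oadd x y) z < oadd (oadd x y) z by rewrite ltxx.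
move/lt_oadd: lt => [lt|[b /lt_oadd [by_|[c cz bc]] le]].
- by apply: lt_le_trans lt _; apply: le_trans (le_oaddr x y) (le_oaddr _ _).
- apply: le_lt_trans le _; apply: lt_le_trans (ltr_oadd x by_) (le_oaddr _ _).
- apply: le_lt_trans (_ : _ <= oadd (oadd x y) c) _; last exact: ltr_oadd.
  apply: le_trans le _; apply: le_trans (IH c cz).
  by move: bc; rewrite le_eqVlt => /predU1P[->|/(ltr_oadd x)/ltW].
Qed.

Lemma omuln_le w w' n : w <= w' -> omuln w n <= omuln w' n.
Proof.
move=> ww; elim: n => //= n IH; apply: le_trans (le_oadd _ IH) _.
by move: ww; rewrite le_eqVlt => /predU1P[->|/(ltr_oadd (omuln w' n))/ltW].
Qed.

Lemma omuln_mono w m n : (m <= n)%N -> omuln w m <= omuln w n.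
Proof.
elim: n => [|n IH]; first by rewrite leqn0 => /eqP ->.
rewrite leq_eqVlt => /predU1P[->//|mn]; apply: le_trans (IH mn) _.
exact: le_oaddr.
Qed.

Lemma oadd_omuln w n : oadd w (omuln w n) <= omuln w n.+1.
Proof.
elim: n => [|n IH] /=; first by rewrite leNgt; apply/negP => /lt_oadd [|[y]];
  rewrite ?oadd0x ?ltxx // ltNge ozero_le.
exact: le_trans (oadd_assoc_le _ _ _) (le_oadd _ IH).
Qed.

Lemma opow_gt0 x : ozero < opow x.
Proof. by apply/lt_opow; left. Qed.

Lemma omuln_lt_opow x y n : x < y -> omuln (opow x) n < opow y.
Proof. by move=> xy; apply/lt_opow; right; exists x, n. Qed.

Lemma opow_le x y : x <= y -> opow x <= opow y.
Proof. by move=> /oleE xy; apply/oclass_le; exact: topow_le. Qed.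

(** An ordinal below omega^(x+1) is at most some omega^x n, so omega^x plus it is at most omega^x
    (n+1). This places the terms of omega^zeta + Gamma_{zeta+1} below omega^(zeta+1), which keeps
    the pieces at a limit apart. *)
Lemma oadd_opow_lt x y : y < opow (osucc x) -> oadd (opow x) y < opow (osucc x).
Proof.
have bnd n : y <= omuln (opow x) n -> oadd (opow x) y < opow (osucc x).
  move=> yn; apply: le_lt_trans (omuln_lt_opow n.+1 (lt_self_osucc x)).
  apply: le_trans (oadd_omuln _ _).
  by move: yn; rewrite le_eqVlt => /predU1P[->|/(ltr_oadd (opow x))/ltW].
move=> /lt_opow[y0|[z [n [/lt_osucc zx yn]]]]; first by apply: (bnd 0%N); rewrite y0.
by apply: (bnd n); apply: le_trans yn _; apply: omuln_le; exact: opow_le.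
Qed.

End OrdinalArithmetic.

(** * Trees of finite sequences and their maximal members *)

Section SequenceTrees.
Context (T : eqType).
Implicit Types (S A B : set (seq T)) (s t u : seq T).

(** The last clause stands in for well-foundedness: every member lies below a maximal one. *)
Definition seqtree S : Prop :=
  [/\ ~ S [::], exists s, S s,
      forall s u, S (s ++ u) -> s != [::] -> S s
    & forall s, S s -> exists u, MAX S (s ++ u)].

Lemma MAX_cat S s u : MAX S s -> S (s ++ u) -> u = [::].
Proof.
case=> _ maxs /maxs/(_ (prefix_prefix _ _)) /eqP.
by rewrite -{2}(cats0 s) eqseq_cat // eqxx => /eqP.
Qed.

Lemma cat_comparable s1 s2 u1 u2 : s1 ++ u1 = s2 ++ u2 ->
  (exists w, s2 = s1 ++ w) \/ (exists w, s1 = s2 ++ w).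
Proof.
move=> E; have [le12|/ltnW le21] := leqP (size s1) (size s2); [left|right].
  exists (drop (size s1) s2); have := congr1 (take (size s1)) E.
  by rewrite take_size_cat // (takel_cat _ le12) => sE; rewrite {1}sE cat_take_drop.
exists (drop (size s2) s1); have := congr1 (take (size s2)) E.
by rewrite [RHS]take_size_cat // (takel_cat _ le21) => sE; rewrite -{1}sE cat_take_drop.
Qed.

Lemma MAX_cat_inj S s1 s2 u1 u2 :
  MAX S s1 -> MAX S s2 -> s1 ++ u1 = s2 ++ u2 -> s1 = s2 /\ u1 = u2.
Proof.
move=> m1 m2 E; suff s12 : s1 = s2.
  by split => //; move/eqP: E; rewrite s12 eqseq_cat // eqxx => /eqP.
case: (cat_comparable E) => [[w sE]|[w sE]].
- have := m2.1; rewrite sE => /(MAX_cat m1) w0; by rewrite w0 cats0.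
- have := m1.1; rewrite sE => /(MAX_cat m2) w0; by rewrite w0 cats0.
Qed.

Definition grafted A B : set (seq T) :=
  A `|` [set s | exists t u, [/\ MAX A t, B u & s = t ++ u]].

(** As [B] has a member and all its members are nonempty, no maximal member of [A] remains maximal
    after the grafting. *)
Lemma MAX_grafted A B s : ~ B [::] -> (exists u, B u) ->
  MAX (grafted A B) s <-> exists t u, [/\ MAX A t, MAX B u & s = t ++ u].
Proof.
move=> B0 [b Bb]; split.
  move=> ms; case: (ms) => -[As|[t [u [mt Bu sE]]]] _.
    have mA : MAX A s by split=> // t At; apply: ms.2; left.
    have /(MAX_cat ms) b0 : grafted A B (s ++ b) by right; exists s, b.
    by move: Bb; rewrite b0.
  exists t, u; split=> //; split=> // v Bv /prefixP[w vE].
  have : grafted A B (s ++ w) by right; exists t, v; rewrite sE vE catA -vE.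
  by move=> /(MAX_cat ms) w0; rewrite vE w0 cats0.
move=> [t [u [mt mu ->]]]; split; first by right; exists t, u; split => //; exact: mu.1.
move=> v [Av|[t' [u' [mt' Bu' ->]]]] /prefixP[w].
  rewrite -catA => vE; move: Av; rewrite vE => /(MAX_cat mt); case: (u) mu => //.
  by move=> [].
rewrite -catA => E; have [-> uE] := MAX_cat_inj mt' mt E.
by congr (_ ++ _); apply: mu.2 => //; rewrite uE prefix_prefix.
Qed.

Lemma seqtree_grafted A B : seqtree A -> seqtree B -> seqtree (grafted A B).
Proof.
move=> [A0 Ai Ap Ae] [B0 Bi Bp Be].
have maxg t u : MAX A t -> MAX B u -> MAX (grafted A B) (t ++ u).
  by move=> mt mu; apply/(MAX_grafted _ _ B0 Bi); exists t, u.
split.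
- by case=> // -[t [u [[At _] Bu]]]; case: t At.
- by case: Ai => s As; exists s; left.
- move=> s v [As|[t [u [mt Bu E]]]] s0; first by left; apply: (Ap s v).
  case: (cat_comparable E) => [[w tE]|[w sE]].
    by left; apply: (Ap s w) => //; rewrite -tE; exact: mt.1.
  have [w0|w0] := eqVneq w [::]; first by left; rewrite sE w0 cats0; exact: mt.1.
  right; exists t, w; split=> //; apply: (Bp w v) => //.
  by move: E; rewrite sE -catA => /eqP; rewrite eqseq_cat // eqxx => /eqP ->.
- move=> s [As|[t [u [mt Bu ->]]]].
    have [v mv] := Ae _ As; have [b /Be[c mb]] := Bi.
    by exists (v ++ (b ++ c)); rewrite catA; exact: maxg.
  by have [c mc] := Be _ Bu; exists c; rewrite -catA; exact: maxg.
Qed.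

Lemma MAX_imset (f : T -> T) S s : injective f ->
  MAX (map f @` S) s <-> exists2 t, MAX S t & s = map f t.
Proof.
move=> fI; split.
  move=> [[t St <-] ms]; exists t => //; split=> // u Su /prefixP[v uE].
  apply: (inj_map fI); apply: ms; first by exists u.
  by rewrite uE map_cat prefix_prefix.
move=> [t [St mt] ->]; split; first by exists t.
move=> _ [u Su <-] /prefixP[v uE]; congr map; apply: mt => //.
apply/prefixP; exists (drop (size t) u).
rewrite -{1}(cat_take_drop (size t) u); congr (_ ++ _); apply: (inj_map fI).
by rewrite map_take uE take_size_cat // size_map.
Qed.

Lemma seqtree_imset (f : T -> T) S : injective f -> seqtree S -> seqtree (map f @` S).
Proof.
move=> fI [S0 [s0 Ss0] Sp Se]; split.
- by move=> [t St /(congr1 size)]; rewrite size_map => /size0nil t0; move: St; rewrite t0.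
- by exists (map f s0), s0.
- move=> s u [t St tE] sn; exists (take (size s) t).
    apply: (Sp _ (drop (size s) t)); first by rewrite cat_take_drop.
    apply: contraNneq sn => t0.
    by rewrite -(take_size_cat (n := size s) u erefl) -tE -map_take t0.
  by rewrite map_take tE take_size_cat.
- move=> _ [t /Se[u mu] <-]; exists (map f u); apply/(MAX_imset _ _ fI).
  by exists (t ++ u) => //; rewrite map_cat.
Qed.

Section Union.
Context (I : Type) (P : set I) (S : I -> set (seq T)).
Context (disj : forall i j x s t, P i -> P j -> S i (x :: s) -> S j (x :: t) -> i = j).
Context (tree : forall i, P i -> seqtree (S i)).

(** By [disj] the first term of a sequence determines its tree, so its extensions in the union stay
    in that tree. *)
Lemma MAX_bigcup s :
  MAX (\bigcup_(i in P) S i) s <-> exists2 i, P i & MAX (S i) s.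
Proof.
split.
  move=> [[i Pi Ss] ms]; exists i => //; split=> // t St; apply: ms; by exists i.
move=> [i Pi [Ss ms]]; split; first by exists i.
move=> t [j Pj St] st; apply: ms => //; case: s Ss st => [|x s] Ss.
  by have [] := tree Pi.
move=> /prefixP[u tE]; move: (St); rewrite tE /= => /(disj Pi Pj Ss) ij.
by rewrite ij; move: St; rewrite tE.
Qed.

Lemma seqtree_bigcup : (exists i, P i) -> seqtree (\bigcup_(i in P) S i).
Proof.
move=> [i0 Pi0]; split.
- by move=> [i Pi]; have [] := tree Pi.
- by have [_ [s Ss] _ _] := tree Pi0; exists s, i0.
- by move=> s u [i Pi Su] s0; exists i => //; have [_ _ Sp _] := tree Pi; exact: Sp Su s0.
- move=> s [i Pi Ss]; have [_ _ _ Se] := tree Pi; have [u mu] := Se _ Ss.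
  by exists u; apply/MAX_bigcup; exists i.
Qed.
End Union.

End SequenceTrees.

(** * The sets Gamma_xi and Gamma_{xi,n} as trees *)

Section GammaStructure.
Local Open Scope order_scope.
Implicit Types (xi zeta x : ordnum) (s t u : seq ordnum).

Lemma grafted_set0 (T : eqType) (A : set (seq T)) : grafted A set0 = A.
Proof. by apply/seteqP; split=> [s [//|[t [u [_ []]]]]|s As]; left. Qed.

Lemma oshift0 s : oshift ozero s = s.
Proof. by rewrite /oshift -[RHS]map_id; apply: eq_map => x; exact: oadd0x. Qed.

(** With Gamma_{xi,0} empty, grafting covers n = 0 as well: the shift is then by [ozero] and nothing
    is attached. *)
Lemma GammaNS xi n :
  GammaN xi n.+1 =
  grafted (oshift (omuln (opow xi) n) @` Gamma xi) (GammaN xi n).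
Proof.
case: n => [|n] //; rewrite [GammaN xi 0]/(set0) grafted_set0.
by apply/seteqP; split=> [s Gs|_ [s Gs <-]]; [exists s|]; rewrite ?oshift0.
Qed.

Lemma in_oshift z s x :
  x \in oshift z s -> exists2 y, y \in s & x = oadd z y.
Proof. by move=> /mapP. Qed.

Lemma GammaN_head xi n x s : seqtree (Gamma xi) ->
  GammaN xi n.+1 (x :: s) -> omuln (opow xi) n <= x.
Proof.
move=> tG; rewrite GammaNS => -[[[|y t] _ //= [<- _]]|]; first exact: le_oaddr.
move=> [t [u [[[t' Gt' <-] _] _]]]; case: t' Gt' => [|y t'] Gt' /=.
  by have [] := tG.
by move=> [-> _]; exact: le_oaddr.
Qed.

Lemma GammaN_lt xi n s x : (forall s x, Gamma xi s -> x \in s -> x < opow xi) ->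
  GammaN xi n s -> x \in s -> x < omuln (opow xi) n.
Proof.
move=> ltG; elim: n s => [|n IH] s; first by [].
have shift_lt t : Gamma xi t -> x \in oshift (omuln (opow xi) n) t ->
    x < omuln (opow xi) n.+1.
  by move=> Gt /in_oshift[y yt ->]; apply: ltr_oadd; exact: ltG yt.
rewrite GammaNS => -[[t Gt <-]|]; first exact: shift_lt.
move=> [_ [u [[[t Gt <-] _] Gu ->]]]; rewrite mem_cat => /orP[|xu].
  exact: shift_lt.
by apply: lt_le_trans (IH _ Gu xu) _; exact: omuln_mono.
Qed.

Lemma seqtree_GammaN xi n : seqtree (Gamma xi) -> seqtree (GammaN xi n.+1).
Proof.
move=> tG; elim: n => // n IH; rewrite GammaNS; apply: seqtree_grafted => //.
by apply: seqtree_imset tG; exact: oadd_inj.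
Qed.

(** The first term of a member of Gamma_{xi,n} is at least omega^xi (n-1) and below omega^xi n,
    which determines n. *)
Lemma GammaN_disjoint xi n m x s t :
  seqtree (Gamma xi) -> (forall s x, Gamma xi s -> x \in s -> x < opow xi) ->
  GammaN xi n (x :: s) -> GammaN xi m (x :: t) -> n = m.
Proof.
move=> tG ltG.
have le k l u v : GammaN xi k (x :: u) -> GammaN xi l (x :: v) -> (k <= l)%N.
  case: k => [//|k] /(GammaN_head tG) kx Gl; have xl := GammaN_lt ltG Gl (mem_head x v).
  rewrite ltnNge; apply/negP => /(omuln_mono (opow xi)) lk.
  by have := lt_le_trans xl (le_trans lk kx); rewrite ltxx.
by move=> Gn Gm; apply/eqP; rewrite eqn_leq (le _ _ _ _ Gn Gm) (le _ _ _ _ Gm Gn).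
Qed.

(** The first term is at least omega^zeta and below omega^(zeta+1), which determines zeta. *)
Lemma shift_disjoint (S : ordnum -> set (seq ordnum)) zeta zeta' x s t :
  (forall zeta, ~ S zeta [::]) ->
  (forall zeta s x, S zeta s -> x \in s -> x < opow (osucc zeta)) ->
  (oshift (opow zeta) @` S zeta) (x :: s) ->
  (oshift (opow zeta') @` S zeta') (x :: t) -> zeta = zeta'.
Proof.
move=> S0 ltS.
have le z z' u v : (oshift (opow z) @` S z) (x :: u) ->
    (oshift (opow z') @` S z') (x :: v) -> z <= z'.
  move=> [[|y r] Sr //= [yx _]] [[|y' r'] Sr' //= [yx' _]].
  rewrite leNgt; apply/negP => /osucc_le/opow_le z'z.
  have := oadd_opow_lt (ltS _ _ _ Sr' (mem_head _ _)); rewrite yx' -yx.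
  by rewrite ltNge (le_trans z'z (le_oaddr _ _)).
by move=> Sz Sz'; apply: le_anti; rewrite (le _ _ _ _ Sz Sz') (le _ _ _ _ Sz' Sz).
Qed.

(** Both statements go through one induction: the bound on the terms separates the pieces of a
    union, and this makes the union a tree. *)
Lemma Gamma_tree_lt xi :
  seqtree (Gamma xi) /\ (forall s x, Gamma xi s -> x \in s -> x < opow xi).
Proof.
elim/(well_founded_ind olt_wf): xi => xi IH; case: (ord_case xi) => [->|[zeta xiE]|xil].
- rewrite Gamma0; split; last first.
    by move=> s x -> /[1!inE] /eqP ->; exact: opow_gt0.
  have m0 : MAX [set [:: ozero]] [:: ozero] by split.
  split=> //.
  + by exists [:: ozero].
  + by move=> [|x [|y s]] u //= [->].
  + by move=> s ->; exists [::].
- move: IH; rewrite xiE => /(_ _ (lt_self_osucc zeta)) [tG ltG].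
  rewrite GammaS; split.
    apply: seqtree_bigcup; last by exists 1%N.
    + by move=> i j x s t _ _; exact: GammaN_disjoint.
    + by case=> // n _; exact: seqtree_GammaN.
  move=> s x [n _ Gs] xs; apply: lt_trans (omuln_lt_opow n (lt_self_osucc zeta)).
  exact: GammaN_lt Gs xs.
- rewrite Gamma_lim //; case: xil => xi0 xil.
  have IH' z : z < xi -> seqtree (Gamma (osucc z)) /\
      (forall s x, Gamma (osucc z) s -> x \in s -> x < opow (osucc z)).
    by move=> /xil; exact: IH.
  split; last first.
    move=> _ x [z zx [s Gs <-]] /in_oshift[y ys ->].
    apply: lt_le_trans (opow_le (osucc_le zx)); apply: oadd_opow_lt.
    exact: (IH' z zx).2 Gs ys.
  apply: seqtree_bigcup; last by exists ozero.
  (* The induction hypothesis reaches only below [xi], so the family is made empty elsewhere; the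
     assumptions of [shift_disjoint] then hold at every ordinal. *)
  + pose S z := [set s | z < xi /\ Gamma (osucc z) s].
    move=> z z' x s t zx z'x Sz Sz'; apply: (@shift_disjoint S z z' x s t).
    * by move=> z0 [/IH'[[]]].
    * by move=> z0 s0 x0 [/IH'[_ ltG]]; exact: ltG.
    * by case: Sz => r Gr rE; exists r.
    * by case: Sz' => r Gr rE; exists r.
  + by move=> z /IH'[tG _]; apply: seqtree_imset tG; exact: oadd_inj.
Qed.

Lemma seqtree_Gamma xi : seqtree (Gamma xi).
Proof. by have [] := Gamma_tree_lt xi. Qed.

Lemma Gamma_nil xi : ~ Gamma xi [::].
Proof. by have [] := seqtree_Gamma xi. Qed.

Lemma GammaN_nil xi n : ~ GammaN xi n [::].
Proof. by case: n => // n; have [] := seqtree_GammaN n (seqtree_Gamma xi). Qed.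

Lemma GammaN_uniq xi n m x s t :
  GammaN xi n (x :: s) -> GammaN xi m (x :: t) -> n = m.
Proof. have [tG ltG] := Gamma_tree_lt xi; exact: GammaN_disjoint. Qed.

Lemma GammaLim_uniq zeta zeta' x s t :
  (oshift (opow zeta) @` Gamma (osucc zeta)) (x :: s) ->
  (oshift (opow zeta') @` Gamma (osucc zeta')) (x :: t) -> zeta = zeta'.
Proof.
apply: (@shift_disjoint (fun z => Gamma (osucc z))) => z.
  exact: Gamma_nil.
by have [] := Gamma_tree_lt (osucc z).
Qed.

Lemma MAX_Gamma0 s : MAX (Gamma ozero) s <-> s = [:: ozero].
Proof. by rewrite Gamma0; split=> [[]//|->]; split. Qed.

Lemma MAX_oshift z (S : set (seq ordnum)) s :
  MAX (oshift z @` S) s <-> exists2 t, MAX S t & s = oshift z t.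
Proof. by apply: MAX_imset; exact: oadd_inj. Qed.

Lemma MAX_GammaS xi s :
  MAX (Gamma (osucc xi)) s <-> exists n, MAX (GammaN xi n.+1) s.
Proof.
rewrite GammaS MAX_bigcup; last first.
- by case=> // n _; exact/seqtree_GammaN/seqtree_Gamma.
- by move=> i j x t u _ _; exact: GammaN_uniq.
by split=> [[[|n] // _ mn]|[n mn]]; [exists n|exists n.+1].
Qed.

Lemma MAX_Gamma_lim xi s : olimit xi ->
  MAX (Gamma xi) s <-> exists zeta t,
    [/\ zeta < xi, MAX (Gamma (osucc zeta)) t & s = oshift (opow zeta) t].
Proof.
move=> xil; rewrite Gamma_lim // MAX_bigcup; last first.
- by move=> z _; apply: seqtree_imset (seqtree_Gamma _); exact: oadd_inj.
- by move=> i j x t u _ _; exact: GammaLim_uniq.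
split=> [[z zx /MAX_oshift[t mt ->]]|[z [t [zx mt ->]]]]; first by exists z, t.
by exists z => //; apply/MAX_oshift; exists t.
Qed.

Lemma MAX_GammaN1 xi s :
  MAX (GammaN xi 1) s <-> exists2 t, MAX (Gamma xi) t & s = oshift (omuln (opow xi) 0) t.
Proof. by rewrite GammaNS [GammaN xi 0]/(set0) grafted_set0; exact: MAX_oshift. Qed.

Lemma MAX_GammaNS xi n s :
  MAX (GammaN xi n.+2) s <-> exists t u,
    [/\ MAX (Gamma xi) t, MAX (GammaN xi n.+1) u & s = oshift (omuln (opow xi) n.+1) t ++ u].
Proof.
have tG := seqtree_Gamma xi; have [G0 Gi _ _] := seqtree_GammaN n tG.
rewrite GammaNS MAX_grafted //; split=> [[_ [u [/MAX_oshift[t mt ->] mu ->]]]|[t [u [mt mu ->]]]].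
  by exists t, u.
by exists (oshift (omuln (opow xi) n.+1) t), u; split=> //; apply/MAX_oshift; exists t.
Qed.

End GammaStructure.

(** * Prunings as strategies *)

Section Histories.
Context (T U : Type).
Implicit Types (h : seq T -> U) (s t : seq T).

Fixpoint history h t : seq U :=
  if t is x :: t' then h [:: x] :: history (fun s => h (x :: s)) t' else [::].

Lemma history_cat h s t :
  history h (s ++ t) = history h s ++ history (fun u => h (s ++ u)) t.
Proof. by elim: s h => //= x s IH h; rewrite IH. Qed.

Lemma history_rcons h s x : history h (rcons s x) = rcons (history h s) (h (rcons s x)).
Proof. by rewrite -cats1 history_cat /= cats1. Qed.

Lemma eq_history h h' t :
  (forall s x u, t = rcons s x ++ u -> h (rcons s x) = h' (rcons s x)) ->
  history h t = history h' t.
Proof.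
elim: t h h' => //= y t IH h h' E; congr (_ :: _); first exact: (E [::] y t).
by apply: IH => s x u tE; apply: (E (y :: s) x u); rewrite tE.
Qed.

End Histories.

Lemma map_history (T U V : Type) (f : U -> V) (h : seq T -> U) t :
  map f (history h t) = history (f \o h) t.
Proof. by elim: t h => //= x t IH h; rewrite IH. Qed.

Lemma history_map (T U V : Type) (f : V -> T) (h : seq T -> U) (t : seq V) :
  history h (map f t) = history (fun s => h (map f s)) t.
Proof. by elim: t h => //= x t IH h; rewrite IH. Qed.

Lemma unzip1_relabel (T : Type) (f : ordnum -> ordnum) (t : seq (ordnum * T)) :
  unzip1 [seq (f x.1, x.2) | x <- t] = map f (unzip1 t).
Proof. by rewrite /unzip1 -!map_comp. Qed.

Definition shiftX (T : Type) z (t : seq (ordnum * T)) := [seq (oadd z x.1, x.2) | x <- t].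

Lemma unzip1_shiftX (T : Type) z (t : seq (ordnum * T)) :
  unzip1 (shiftX z t) = oshift z (unzip1 t).
Proof. exact: unzip1_relabel. Qed.

Lemma size_shiftX (T : Type) z (t : seq (ordnum * T)) : size (shiftX z t) = size t.
Proof. exact: size_map. Qed.

(** An extension of the ordinals lifts to the labelled sequence by giving the new terms a fixed
    label [U0]. *)
Lemma MAX_labelled (D : choiceType) (S : set (seq ordnum)) (t : seq (ordnum * D)) :
  inhabited D -> MAX (labelled S D) t <-> MAX S (unzip1 t).
Proof.
move=> [U0]; split=> -[St mt]; split=> //.
  move=> s Ss /prefixP[u sE].
  have uE : unzip1 (t ++ [seq (x, U0) | x <- u]) = s.
    by rewrite sE /unzip1 map_cat -map_comp -[in RHS](map_id u).
  rewrite -uE (mt (t ++ _)) ?prefix_prefix //.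
  by rewrite /labelled /= uE.
move=> s Ss /prefixP[u sE].
have := mt (unzip1 s) Ss; rewrite sE /unzip1 map_cat prefix_prefix => /(_ isT).
move/(congr1 size); rewrite size_cat !size_map => /eqP.
by rewrite -[X in _ == X]addn0 eqn_add2l size_eq0 => /eqP ->; rewrite cats0.
Qed.

Section Strategies.
Context (d : Order.disp_t) (D : preorderType d).
Local Notation X := (ordnum * D)%type.
Implicit Types (S A B : set (seq ordnum)) (Phi Psi : seq (seq X) -> Prop).

(** The empty sequence is refused, so the values of a strategy along a maximal branch are
    nonempty. *)
Definition dominates (U : D) (y : seq X) : Prop :=
  if y is a :: y' then (U <= (last a y').2)%O else False.

(* A strategy for Phi along S: the map h plays the part of a pruning, except that
   the tree containing its values is only constrained through Phi, which is
   required of the values of h along every maximal branch of S. *)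
Definition strategy S Phi : Prop :=
  exists h : seq X -> seq X, forall t, MAX S (unzip1 t) ->
    (forall s x u, t = rcons s x ++ u -> dominates x.2 (h (rcons s x))) /\
    Phi (history h t).

Lemma strategy_map S Phi Psi (tau : seq X -> seq X) :
  (forall U y, dominates U y -> dominates U (tau y)) ->
  (forall hs, Phi hs -> Psi (map tau hs)) ->
  strategy S Phi -> strategy S Psi.
Proof.
move=> dtau PhiPsi [h H]; exists (tau \o h) => t /H[dom /PhiPsi]; rewrite map_history.
by split=> // s x u tE; apply: dtau; exact: dom tE.
Qed.

Lemma strategy_imp S Phi Psi :
  (forall hs, Phi hs -> Psi hs) -> strategy S Phi -> strategy S Psi.
Proof. by move=> PhiPsi; apply: (@strategy_map _ _ _ id) => // hs; rewrite map_id; exact: PhiPsi. Qed.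

(** The ordinals of a branch enter the definition of [strategy] only through maximality, so a map of
    ordinals that preserves maximal branches pulls strategies back. *)
Lemma strategy_relabel S S' Phi (f : ordnum -> ordnum) :
  (forall s, MAX S s -> MAX S' (map f s)) -> strategy S' Phi -> strategy S Phi.
Proof.
move=> SS' [h H]; pose g (x : X) := (f x.1, x.2).
exists (h \o map g) => t /SS'; rewrite -unzip1_relabel -/g => /H[dom].
rewrite history_map; split=> // s x u tE /=.
rewrite map_rcons; apply: (dom _ (g x) (map g u)).
by rewrite tE map_cat map_rcons.
Qed.

Lemma strategy_sub S S' Phi :
  (forall s, MAX S s -> MAX S' s) -> strategy S' Phi -> strategy S Phi.
Proof. by move=> SS'; apply: (@strategy_relabel _ _ _ id) => s; rewrite map_id; exact: SS'. Qed.

Lemma strategy_shift z S Phi : strategy S Phi -> strategy (oshift z @` S) Phi.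
Proof.
pose g x := xget ozero [set y | oadd z y = x].
have gK y : g (oadd z y) = y.
  by apply: xget_unique => // w /oadd_inj.
apply: (@strategy_relabel _ _ _ g) => _ /MAX_oshift[t mt ->].
by rewrite /oshift -map_comp (eq_map gK) map_id.
Qed.

Lemma strategy_unshift z S Phi : strategy (oshift z @` S) Phi -> strategy S Phi.
Proof. by apply: (@strategy_relabel _ _ _ (oadd z)) => s ms; apply/MAX_oshift; exists s. Qed.

Lemma strategy_ex S Phi :
  inhabited D -> seqtree S -> strategy S Phi -> exists hs, Phi hs.
Proof.
move=> [U0] [_ [s Ss] _ /(_ s Ss)[u mu]] [h /(_ [seq (x, U0) | x <- s ++ u])].
rewrite /unzip1 -map_comp map_id => /(_ mu)[_ Phih]; by exists (history h [seq (x, U0) | x <- s ++ u]).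
Qed.

(** Follow the first strategy until a maximal branch [a] of [A] is complete, then the strategy on
    [B] that the condition provides for the history along [a]. *)
Lemma strategy_grafted A B Phi : seqtree A -> seqtree B ->
  strategy A (fun hs => strategy B (fun hs' => Phi (hs ++ hs'))) ->
  strategy (grafted A B) Phi.
Proof.
move=> tA [B0 Bi _ _] [h1 H1].
have /choice [h2 H2] : forall a : seq X, exists h2 : seq X -> seq X,
    MAX A (unzip1 a) -> forall b, MAX B (unzip1 b) ->
    (forall s x u, b = rcons s x ++ u -> dominates x.2 (h2 (rcons s x))) /\
    Phi (history h1 a ++ history h2 b).
  move=> a; have [/H1[_ [h2 H2]]|na] := pselect (MAX A (unzip1 a)); last by exists id.
  by exists h2.
(* The second part must be nonempty, so that a complete branch of [A] is itself still answered by
   [h1]. *)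
pose split_at (s : seq X) (p : seq X * seq X) :=
  [/\ MAX A (unzip1 p.1), p.2 != [::] & s = p.1 ++ p.2].
have split_uniq s p q : split_at s p -> split_at s q -> p = q.
  case: p q => [p1 p2] [q1 q2] [/= mp _ sp] [/= mq _ sq].
  have E : p1 ++ p2 = q1 ++ q2 by rewrite -sp.
  have E1 : unzip1 p1 ++ unzip1 p2 = unzip1 q1 ++ unzip1 q2.
    by rewrite /unzip1 -!map_cat E.
  have [/(congr1 size)] := MAX_cat_inj mp mq E1; rewrite !size_map => sz _.
  by move/eqP: E; rewrite eqseq_cat // => /andP[/eqP -> /eqP ->].
pose h s := if pselect (exists p, split_at s p) is left e then
  let p := projT1 (cid e) in h2 p.1 p.2 else h1 s.
have hE s p : split_at s p -> h s = h2 p.1 p.2.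
  rewrite /h => sp; case: pselect => [e|[]]; last by exists p.
  by case: cid => q sq /=; rewrite (split_uniq _ _ _ sp sq).
have hN a s u : MAX A (unzip1 a) -> a = s ++ u -> h s = h1 s.
  move=> ma aE; rewrite /h; case: pselect => // sp; exfalso; case: sp => -[p q] [/= mp q0 sE].
  have := ma.1; rewrite aE sE -catA /unzip1 !map_cat => /(MAX_cat mp).
  by case: (q) q0.
exists h => t /(MAX_grafted _ _ B0 Bi)[a1 [b1 [ma mb tE]]].
have [a [b [{}tE aE bE]]] : exists a b, [/\ t = a ++ b, unzip1 a = a1 & unzip1 b = b1].
  exists (take (size a1) t), (drop (size a1) t); split; first by rewrite cat_take_drop.
    by rewrite /unzip1 map_take -/(unzip1 t) tE take_size_cat.
  by rewrite /unzip1 map_drop -/(unzip1 t) tE drop_size_cat.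
move: ma mb; rewrite -{}aE -{}bE => ma mb {a1 b1}.
have [dom1 _] := H1 a ma; have [dom2 Phih] := H2 a ma b mb.
have hb s : s != [::] -> h (a ++ s) = h2 a s by move=> s0; exact: (hE _ (a, s)).
split; last first.
  rewrite tE history_cat (@eq_history _ _ h h1) => [|s x u aE]; last exact: hN aE.
  rewrite (@eq_history _ _ (fun u => h (a ++ u)) (h2 a)) // => s x u bE.
  by apply: hb; case: (s).
move=> s x u; rewrite tE => E.
have [[w sE]|[w sE]] := cat_comparable (esym E).
  by rewrite (hN a _ w ma sE); exact: dom1 sE.
have [w0|] := eqVneq w [::].
  rewrite (hN a _ [::] ma); last by rewrite sE w0 !cats0.
  by apply: (dom1 _ _ [::]); rewrite sE w0 !cats0.
case/lastP: w sE => [//|w y] sE _.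
move: (sE); rewrite -rcons_cat => /rcons_inj[sE' xE].
rewrite sE hb; last by case: (w).
rewrite xE; apply: (dom2 _ _ u).
by move/eqP: E; rewrite sE -catA eqseq_cat // eqxx /= => /eqP.
Qed.

(** The first term of a branch reveals its tree, so the strategy for that tree can be followed from
    the start. *)
Lemma strategy_bigcup (I : choiceType) (P : set I) (S : I -> set (seq ordnum)) Phi (i0 : I) :
  (forall i j x s t, P i -> P j -> S i (x :: s) -> S j (x :: t) -> i = j) ->
  (forall i, P i -> seqtree (S i)) ->
  (forall i, P i -> strategy (S i) Phi) -> strategy (\bigcup_(i in P) S i) Phi.
Proof.
move=> disj tree H.
have /choice [hh Hh] : forall i, exists h : seq X -> seq X, P i -> forall t, MAX (S i) (unzip1 t) ->
    (forall s x u, t = rcons s x ++ u -> dominates x.2 (h (rcons s x))) /\ Phi (history h t).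
  move=> i; have [/H[h Hh]|nP] := pselect (P i); [by exists h|by exists id].
pose h (s : seq X) := if s is x :: s' then
  hh (xget i0 [set i | P i /\ exists u, S i (x.1 :: u)]) s else [::].
exists h => t /MAX_bigcup; move=> /(_ disj tree)[i Pi mt].
have [dom Phih] := Hh i Pi t mt.
have hE s x u : t = rcons s x ++ u -> h (rcons s x) = hh i (rcons s x).
  move=> tE; have [y [s' sE]] : exists y s', rcons s x = y :: s'.
    by case: (s) => [|y s']; [exists x, [::]|exists y, (rcons s' x)].
  rewrite sE /=; congr hh; apply: xget_unique.
    split=> //; exists (unzip1 (s' ++ u)).
    by have := mt.1; rewrite tE sE.
  move=> j [Pj [v Sj]]; apply: disj Pj Pi Sj _.
  by have := mt.1; rewrite tE sE; exact.
split=> [s x u tE|]; first by rewrite (hE _ _ _ tE); exact: dom tE.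
by rewrite (eq_history hE).
Qed.

(** These are [n] rounds on Gamma_xi, the strategy of each round depending on the histories of the
    earlier ones; [Phi] judges the joined histories. *)
Fixpoint strategies xi n Phi : Prop :=
  if n is n'.+1 then
    strategy (Gamma xi) (fun hs => strategies xi n' (fun hs' => Phi (hs ++ hs')))
  else Phi [::].

Lemma strategies_map xi n Phi Psi (tau : seq X -> seq X) :
  (forall U y, dominates U y -> dominates U (tau y)) ->
  (forall hs, Phi hs -> Psi (map tau hs)) ->
  strategies xi n Phi -> strategies xi n Psi.
Proof.
move=> dtau; elim: n Phi Psi => [|n IH] Phi Psi PhiPsi /=; first exact: PhiPsi.
apply: strategy_map dtau _ => hs; apply: IH => hs' /PhiPsi.
by rewrite map_cat.
Qed.

Lemma strategies_ex xi n Phi : inhabited D -> strategies xi n Phi -> exists hs, Phi hs.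
Proof.
move=> iD; elim: n Phi => [|n IH] Phi /=; first by exists [::].
move=> /(strategy_ex iD (seqtree_Gamma xi))[hs /IH[hs' Phihs]].
by exists (hs ++ hs').
Qed.

Lemma strategies_GammaN xi n Phi : strategies xi n.+1 Phi -> strategy (GammaN xi n.+1) Phi.
Proof.
elim: n Phi => [|n IH] Phi /=.
  by apply: strategy_imp => hs; rewrite cats0.
rewrite GammaNS => H; apply: strategy_grafted.
- by apply: seqtree_imset (seqtree_Gamma _); exact: oadd_inj.
- exact/seqtree_GammaN/seqtree_Gamma.
by apply: strategy_shift; apply: strategy_imp H => hs; exact: IH.
Qed.

Lemma strategy_GammaS xi Phi :
  (forall n, strategy (GammaN xi n.+1) Phi) -> strategy (Gamma (osucc xi)) Phi.
Proof.
move=> H; rewrite GammaS; apply: strategy_bigcup; first exact: 0%N.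
- by move=> i j x s t _ _; exact: GammaN_uniq.
- by case=> // n _; exact/seqtree_GammaN/seqtree_Gamma.
- by case.
Qed.

Lemma strategy_Gamma_lim xi Phi : olimit xi ->
  (forall zeta, (zeta < xi)%O -> strategy (Gamma (osucc zeta)) Phi) ->
  strategy (Gamma xi) Phi.
Proof.
move=> xil H; rewrite Gamma_lim //; apply: strategy_bigcup; first exact: ozero.
- by move=> i j x s t _ _; exact: GammaLim_uniq.
- by move=> z _; apply: seqtree_imset (seqtree_Gamma _); exact: oadd_inj.
- by move=> z /H; exact: strategy_shift.
Qed.

(** A strategy restricts to each piece of a union: Gamma_eta is a piece of Gamma_{eta+1}, and
    omega^zeta + Gamma_{zeta+1} is a piece of Gamma_xi when xi is a limit above zeta. *)
Lemma strategy_Gamma_mono zeta xi Phi : (zeta <= xi)%O ->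
  strategy (Gamma xi) Phi -> strategy (Gamma zeta) Phi.
Proof.
elim/(well_founded_ind olt_wf): xi zeta => xi IH zeta.
rewrite le_eqVlt => /predU1P[->//|zx].
case: (ord_case xi) => [xi0|[eta xiE]|xil].
- by move: zx; rewrite xi0 ltNge ozero_le.
- move: IH zx; rewrite xiE => /(_ _ (lt_self_osucc eta)) IH /lt_osucc ze Gxi.
  apply: IH ze _; apply: strategy_sub Gxi => s ms.
  by apply/MAX_GammaS; exists 0%N.
- move=> Gxi; apply: (IH (osucc zeta)); first by case: xil => _; apply.
    exact/ltW/lt_self_osucc.
  apply: (@strategy_unshift (opow zeta)); apply: strategy_sub Gxi.
  by move=> _ /MAX_oshift[t mt ->]; apply/MAX_Gamma_lim => //; exists zeta, t.
Qed.

End Strategies.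

(** * The probabilities *)

Section Decompositions.
Context (xi : ordnum).
Implicit Types (ts : seq (seq ordnum)).

Fixpoint block_chain ts : Prop :=
  if ts is a :: ts' then
    if ts' is [::] then Gamma xi a else MAX (Gamma xi) a /\ block_chain ts'
  else False.

Definition join_blocks n ts : seq ordnum :=
  flatten [seq oshift (omuln (opow xi) (n - i.+1)) (nth [::] ts i) | i <- iota 0 (size ts)].

Lemma join_blocks0 n : join_blocks n [::] = [::].
Proof. by []. Qed.

Lemma join_blocks_cons n a ts :
  join_blocks n.+1 (a :: ts) = oshift (omuln (opow xi) n) a ++ join_blocks n ts.
Proof.
rewrite /join_blocks /= subSS subn0 (iotaDl 1 0) -map_comp; by [].
Qed.

Lemma block_chainP ts :
  block_chain ts <-> [/\ (0 < size ts)%N,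
    forall i, (i < size ts)%N -> Gamma xi (nth [::] ts i)
    & forall i, (i < (size ts).-1)%N -> MAX (Gamma xi) (nth [::] ts i)].
Proof.
elim: ts => [|a [|b ts] IH]; first by split=> [//|[]].
  by split=> [Ga|[_ /(_ 0%N) Ga _]]; [split=> // -[]|exact: Ga].
change (block_chain [:: a, b & ts]) with (MAX (Gamma xi) a /\ block_chain (b :: ts)).
split=> [[ma /IH[_ HG HM]]|[_ HG HM]].
  by split=> // -[|i] /= ib; [exact: ma.1|exact: HG|exact: ma|exact: HM].
split; first exact: (HM 0%N).
by apply/IH; split=> // i ib; [exact: (HG i.+1)|exact: (HM i.+1)].
Qed.

Lemma join_blocks_nil n ts : block_chain ts -> join_blocks n ts <> [::].
Proof.
case: ts => [//|a ts] H; rewrite /join_blocks /=.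
have Ga : Gamma xi a by case: ts H => [//|b ts] [[]].
by case: a Ga {H} => // /Gamma_nil.
Qed.

Lemma join_blocks_inj n ts ts' : (size ts <= n)%N ->
  block_chain ts -> block_chain ts' -> join_blocks n ts = join_blocks n ts' -> ts = ts'.
Proof.
have sinj z : injective (oshift z) by apply: inj_map; exact: oadd_inj.
have sMAX z a : MAX (Gamma xi) a -> MAX (oshift z @` Gamma xi) (oshift z a).
  by move=> ma; apply/MAX_oshift; exists a.
elim: ts ts' n => [//|a ts IH] [//|a' ts'] [//|n] sz H H'.
rewrite !join_blocks_cons.
case: ts ts' IH sz H H' => [|b ts] [|b' ts'] IH sz H H'.
- by rewrite !cats0 => /sinj ->.
- rewrite join_blocks0 cats0 => E; case: H' => ma' Hb'; case: (@join_blocks_nil n (b' :: ts') Hb').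
  by apply: MAX_cat (sMAX (omuln (opow xi) n) _ ma') _; rewrite -E; exists a.
- rewrite join_blocks0 cats0 => E; case: H => ma Hb; case: (@join_blocks_nil n (b :: ts) Hb).
  by apply: MAX_cat (sMAX (omuln (opow xi) n) _ ma) _; rewrite E; exists a'.
- case: H H' => ma Hb [ma' Hb'] E0; move: E0 => /(MAX_cat_inj (sMAX _ _ ma) (sMAX _ _ ma'))[/sinj -> E].
  by congr (_ :: _); exact: IH E.
Qed.

End Decompositions.

Section Iota.
Context (D : Type).
Implicit Types (xi : ordnum) (t u r : seq (ordnum * D)).

Lemma is_iotaE xi n t r : is_iota xi n t r <-> exists ts,
  [/\ (size ts <= n)%N, block_chain xi ts, unzip1 t = join_blocks xi n ts
    & r = zip (last [::] ts) (drop (size t - size (last [::] ts)) (unzip2 t))].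
Proof.
split=> -[ts].
  move=> [/andP[s0 sn] HG HM tE rE]; exists ts; split=> //.
  by apply/block_chainP.
by move=> [sn /block_chainP[s0 HG HM] tE rE]; exists ts; split=> //; rewrite s0.
Qed.

Lemma is_iota_uniq xi n t r r' : is_iota xi n t r -> is_iota xi n t r' -> r = r'.
Proof.
move=> /is_iotaE[ts [sn H tE ->]] /is_iotaE[ts' [_ H' tE' ->]].
by rewrite (join_blocks_inj sn H H') // -tE.
Qed.

Lemma is_iota_one xi n t : Omega D xi t ->
  is_iota xi n.+1 (shiftX (omuln (opow xi) n) t) t.
Proof.
move=> Gt; apply/is_iotaE; exists [:: unzip1 t]; split=> //.
  by rewrite join_blocks_cons cats0 unzip1_shiftX.
rewrite /= size_shiftX size_map subnn drop0.
by rewrite /shiftX /unzip2 -map_comp -[LHS]zip_unzip.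
Qed.

Lemma is_iota_cons xi n t u r : MAX (Gamma xi) (unzip1 t) -> is_iota xi n u r ->
  is_iota xi n.+1 (shiftX (omuln (opow xi) n) t ++ u) r.
Proof.
move=> mt /is_iotaE[ts [sn H uE rE]]; apply/is_iotaE; exists (unzip1 t :: ts).
case: ts sn H uE rE => // b ts sn H uE rE; split=> //.
  by rewrite join_blocks_cons -uE /unzip1 map_cat -/(unzip1 _) unzip1_shiftX.
rewrite rE [last _ (_ :: _)]/(last [::] (b :: ts)) size_cat /unzip2 map_cat drop_cat.
(* The last block lies inside [u], hence all labels of [t] are dropped. *)
have le : (size (last [::] (b :: ts)) <= size u)%N.
  rewrite -(size_map fst) -/(unzip1 u) uE {mt H uE rE}.
  elim: ts b n sn => [|c ts IH] b [//|n] sn; rewrite join_blocks_cons size_cat.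
    by rewrite size_map leq_addr.
  by apply: leq_trans (IH c n sn) _; rewrite leq_addl.
by rewrite size_map -addnBA // ltnNge leq_addr /= addKn.
Qed.

Lemma unzip1_oshift z s t : unzip1 t = oshift z s ->
  exists2 t', t = shiftX z t' & unzip1 t' = s.
Proof.
elim: t s => [|[x U] t IH] [|y s] //=; first by exists [::].
by move=> [-> /IH[t' -> <-]]; exists ((y, U) :: t').
Qed.

Lemma unzip1_cat (s1 s2 : seq ordnum) t : unzip1 t = s1 ++ s2 ->
  exists t1 t2, [/\ t = t1 ++ t2, unzip1 t1 = s1 & unzip1 t2 = s2].
Proof.
move=> tE; exists (take (size s1) t), (drop (size s1) t).
rewrite cat_take_drop /unzip1 map_take map_drop -/(unzip1 t) tE.
by rewrite take_size_cat // drop_size_cat.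
Qed.

Lemma OmegaN_cases xi n t : OmegaN D xi n.+1 t ->
  (exists2 t', Omega D xi t' & t = shiftX (omuln (opow xi) n) t') \/
  (exists t1 t2, [/\ MAX (Gamma xi) (unzip1 t1), OmegaN D xi n t2
                   & t = shiftX (omuln (opow xi) n) t1 ++ t2]).
Proof.
rewrite /OmegaN /labelled /= GammaNS => -[[s Gs /esym/unzip1_oshift[t' -> t's]]|].
  by left; exists t' => //; rewrite /Omega /labelled /= t's.
move=> [_ [u [/MAX_oshift[s ms ->] Gu /unzip1_cat[t1 [t2 [-> /unzip1_oshift[t1' -> t1E] t2E]]]]]].
by right; exists t1', t2; rewrite t1E /labelled /= t2E.
Qed.

Lemma OmegaN_iota xi n t : OmegaN D xi n t -> exists2 r, Omega D xi r & is_iota xi n t r.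
Proof.
elim: n t => [//|n IH] t /OmegaN_cases[[t' Gt' ->]|[t1 [t2 [mt1 /IH[r Gr ir] ->]]]].
  by exists t' => //; exact: is_iota_one.
by exists r => //; exact: is_iota_cons.
Qed.

Lemma OmegaN_shift xi n t : Omega D xi t ->
  OmegaN D xi n.+1 (shiftX (omuln (opow xi) n) t).
Proof.
move=> Gt; rewrite /OmegaN /labelled /= unzip1_shiftX GammaNS; left.
by exists (unzip1 t).
Qed.

Lemma OmegaN_graft xi n t u : MAX (Gamma xi) (unzip1 t) -> OmegaN D xi n u ->
  OmegaN D xi n.+1 (shiftX (omuln (opow xi) n) t ++ u).
Proof.
move=> mt Gu; rewrite /OmegaN /labelled /= /unzip1 map_cat -!/(unzip1 _) unzip1_shiftX GammaNS.
right; exists (oshift (omuln (opow xi) n) (unzip1 t)), (unzip1 u); split=> //.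
by apply/MAX_oshift; exists (unzip1 t).
Qed.

Lemma OmegaN_uniq xi n m t : OmegaN D xi n t -> OmegaN D xi m t -> n = m.
Proof.
case: t => [/GammaN_nil//|[x U] t]; exact: GammaN_uniq.
Qed.

End Iota.

Section Probabilities.
Context (R : realType) (D : Type).
Implicit Types (xi : ordnum) (t u r : seq (ordnum * D)) (p : R).

Lemma is_Pxi_succ xi t p : is_Pxi (osucc xi) t p -> exists n r p',
  [/\ OmegaN D xi n t, is_iota xi n t r, is_Pxi xi r p' & p = n%:R^-1 * p'].
Proof.
move E: (osucc xi) => zeta H; case: H E => [U /osucc_neq0//|z n s r q n1 Gs ir Pr|z y s q zl _ _ _ E].
  by move=> /osucc_inj ->; exists n, r, q.
by move: zl; rewrite -E => /olimit_neq_osucc.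
Qed.

Lemma is_Pxi_lim_inv xi t p : olimit xi -> is_Pxi xi t p -> exists zeta t',
  [/\ (zeta < xi)%O, Omega D (osucc zeta) t', is_Pxi (osucc zeta) t' p
    & t = shiftX (opow zeta) t'].
Proof.
move=> xil H; case: H xil => [U [] |z n s r q _ _ _ _ /olimit_neq_osucc//|z y s q _ yz Gs Ps _].
  by rewrite ltxx.
by exists y, s.
Qed.

Lemma is_Pxi_uniq xi t p p' : is_Pxi xi t p -> is_Pxi xi t p' -> p = p'.
Proof.
elim/(well_founded_ind olt_wf): xi t p p' => xi IH t p p'.
case: (ord_case xi) => [->|[zeta xiE]|xil].
- have zero s (q : R) : is_Pxi ozero s q -> q = 1.
    move E: ozero => z H; case: H E => // [x n ? ? ? _ _ _ _ /esym/osucc_neq0//|x y ? ? [xl _] _ _ _ xE].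
    by move: xl; rewrite -xE ltxx.
  by move=> /zero -> /zero ->.
- move: IH; rewrite xiE => /(_ _ (lt_self_osucc zeta)) IH.
  move=> /is_Pxi_succ[n [r [q [Gn ir Pr ->]]]] /is_Pxi_succ[m [r' [q' [Gm ir' Pr' ->]]]].
  move: ir' Pr'; rewrite -(OmegaN_uniq Gn Gm) => /(is_iota_uniq ir) <- Pr'.
  by rewrite (IH _ _ _ Pr Pr').
- move=> /(is_Pxi_lim_inv xil)[z [s [zx Gs Ps ->]]].
  move=> /(is_Pxi_lim_inv xil)[z' [s' [zx' Gs' Ps' E]]].
  have zz' : z = z'.
    have := congr1 unzip1 E; rewrite !unzip1_shiftX => E1.
    move: Gs E1; rewrite /Omega /labelled /=; case: (unzip1 s) => [/Gamma_nil//|x v] Gs E1.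
    apply: (@GammaLim_uniq z z' (oadd (opow z) x) (oshift (opow z) v) (oshift (opow z) v)).
      by exists (x :: v).
    by exists (unzip1 s').
  move: zz' E Gs' Ps' => <- E _; suff <- : s = s'.
    by apply: IH Ps; case: xil => _; apply.
  by apply: inj_map E => -[a b] [a' b'] [/oadd_inj -> ->].
Qed.

Lemma is_Pxi_ge0 xi t p : is_Pxi xi t p -> 0 <= p.
Proof. by elim=> // {xi t p}xi n t r p _ _ _ _ p0; rewrite mulr_ge0. Qed.

Lemma is_Pxi_exists xi t : Omega D xi t -> exists p, is_Pxi xi t p.
Proof.
elim/(well_founded_ind olt_wf): xi t => xi IH t.
case: (ord_case xi) => [->|[zeta xiE]|xil].
- rewrite /Omega /labelled /= Gamma0.
  by case: t => [|[x U] [|y t]] //= [->]; exists 1; exact: is_Pxi0.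
- move: IH; rewrite xiE => /(_ _ (lt_self_osucc zeta)) IH.
  rewrite /Omega /labelled /= GammaS => -[[//|n] _ Gt].
  have [r /IH[p Pr] ir] := OmegaN_iota Gt.
  by exists (n.+1%:R^-1 * p); exact: is_PxiS Gt ir Pr.
- rewrite /Omega /labelled /= Gamma_lim // => -[z zx [s Gs /esym/unzip1_oshift[t' tE t's]]].
  have Gt' : Omega D (osucc z) t' by rewrite /Omega /labelled /= t's.
  have [p Pt'] := IH _ (xil.2 z zx) t' Gt'.
  by exists p; rewrite tE; exact: is_Pxi_lim.
Qed.

Lemma PxiP xi t : Omega D xi t -> is_Pxi xi t (Pxi R xi t).
Proof.
move=> /is_Pxi_exists[p Pp]; rewrite /Pxi; case: xgetP => [q _ //|/(_ p)].
by case.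
Qed.

Lemma Pxi_eq xi t p : is_Pxi xi t p -> Pxi R xi t = p.
Proof.
by move=> Pp; apply: xget_unique => // q /= Pq; exact: is_Pxi_uniq Pq Pp.
Qed.

Lemma Pxi_ge0 xi t : 0 <= Pxi R xi t.
Proof. by rewrite /Pxi; case: xgetP => // q _; exact: is_Pxi_ge0. Qed.

Lemma Pxi_zero (U : D) : Pxi R ozero [:: (ozero, U)] = 1.
Proof. exact/Pxi_eq/is_Pxi0. Qed.

Lemma Pxi_iota xi n t r : OmegaN D xi n t -> is_iota xi n t r ->
  n%:R * Pxi R (osucc xi) t = Pxi R xi r.
Proof.
case: n => [//|n] Gt ir; have [r' Gr' ir'] := OmegaN_iota Gt.
rewrite -(is_iota_uniq ir ir') in Gr'.
by rewrite (Pxi_eq (is_PxiS (isT : (1 <= n.+1)%N) Gt ir (PxiP Gr'))) mulVKf // pnatr_eq0.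
Qed.

Lemma Pxi_first xi n t : Omega D xi t ->
  n.+1%:R * Pxi R (osucc xi) (shiftX (omuln (opow xi) n) t) = Pxi R xi t.
Proof. by move=> Gt; apply: Pxi_iota (OmegaN_shift n Gt) (is_iota_one n Gt). Qed.

(** Prepending a block does not change iota, so both sides are P_xi of the same sequence; the
    factors clear the denominators 1/(n+1) and 1/n. *)
Lemma Pxi_rest xi n t u : MAX (Gamma xi) (unzip1 t) -> OmegaN D xi n u ->
  n.+1%:R * Pxi R (osucc xi) (shiftX (omuln (opow xi) n) t ++ u) =
  n%:R * Pxi R (osucc xi) u.
Proof.
move=> mt Gu; have [r Gr ir] := OmegaN_iota Gu.
rewrite (Pxi_iota Gu ir); apply: Pxi_iota; first exact: OmegaN_graft.
exact: is_iota_cons.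
Qed.

Lemma Pxi_lim xi zeta t : olimit xi -> (zeta < xi)%O -> Omega D (osucc zeta) t ->
  Pxi R xi (shiftX (opow zeta) t) = Pxi R (osucc zeta) t.
Proof. by move=> xil zx Gt; apply: Pxi_eq; apply: is_Pxi_lim => //; exact: PxiP. Qed.

End Probabilities.

(** * Averages along a branch and over its blocks *)

Section WeightedSums.
Context (R : realType) (T : Type).
Implicit Types (p : seq T -> R) (t u : seq T) (v w : nat -> R).

(** On a fixed branch [t] an initial segment is known by its length, so [v] is a function of
    lengths; the empty segment is left out. *)
Definition wsum p t v : R := \sum_(0 <= j < size t) p (take j.+1 t) * v j.+1.

Lemma wsum_cat p t u v :
  wsum p (t ++ u) v =
  wsum p t v + wsum (fun s => p (t ++ s)) u (fun j => v (size t + j)%N).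
Proof.
rewrite /wsum size_cat (@big_cat_nat _ _ _ (size t)) ?leq_addr //=; congr (_ + _).
  apply: eq_big_nat => j /andP[_ jt]; by rewrite takel_cat.
rewrite -{1}[size t]add0n big_addn addKn; apply: eq_bigr => j _.
by rewrite -addSn addnC take_cat ltnNge leq_addr /= addKn addnC.
Qed.

Lemma eq_wsum p p' t v :
  (forall j, (0 < j <= size t)%N -> p (take j t) = p' (take j t)) -> wsum p t v = wsum p' t v.
Proof. by move=> E; apply: eq_big_nat => j jt; rewrite E. Qed.

Lemma wsum_map p (f : T -> T) t v : wsum p (map f t) v = wsum (p \o map f) t v.
Proof. by rewrite /wsum size_map; apply: eq_bigr => j _; rewrite /= map_take. Qed.

Lemma wsum_scale (c : R) p t v : wsum (fun s => c * p s) t v = c * wsum p t v.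
Proof. by rewrite /wsum mulr_sumr; apply: eq_bigr => j _; rewrite mulrA. Qed.

Lemma ler_wsum p t v w : (forall s, 0 <= p s) ->
  (forall j, (j <= size t)%N -> v j <= w j) -> wsum p t v <= wsum p t w.
Proof.
by move=> p0 vw; apply: ler_sum_nat => j /andP[_ jt]; apply: ler_wpM2l => //; exact: vw.
Qed.

Lemma wsum_addc p t v c :
  wsum p t (fun j => v j + c) = wsum p t v + c * wsum p t (fun=> 1).
Proof.
rewrite /wsum mulr_sumr -big_split /=; apply: eq_bigr => j _.
by rewrite mulrDr mulr1 [c * _]mulrC.
Qed.

Lemma wsum_cst p t c : wsum p t (fun=> c) = c * wsum p t (fun=> 1).
Proof. by rewrite /wsum mulr_sumr; apply: eq_bigr => j _; rewrite mulr1 mulrC. Qed.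

End WeightedSums.

Section Blocks.
Context (R : realType) (D : Type) (xi : ordnum).
Local Notation X := (ordnum * D)%type.
Implicit Types (t b : seq X) (bs : seq (seq X)) (v : nat -> R).

Fixpoint blocks bs : Prop :=
  if bs is b :: bs' then MAX (Gamma xi) (unzip1 b) /\ blocks bs' else True.

(** Blocks are stored without their shifts, which the number of blocks still to come restores. *)
Fixpoint flat bs : seq X :=
  if bs is b :: bs' then shiftX (omuln (opow xi) (size bs')) b ++ flat bs' else [::].

Fixpoint blocksum bs v : R :=
  if bs is b :: bs' then wsum (Pxi R xi) b v + blocksum bs' (fun j => v (size b + j)%N)
  else 0.

Lemma MAX_flat bs : bs <> [::] -> blocks bs -> MAX (GammaN xi (size bs)) (unzip1 (flat bs)).
Proof.
elim: bs => // b [|b' bs] IH _ [mb /= Hbs].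
  rewrite cats0 unzip1_shiftX; apply/MAX_GammaN1; by exists (unzip1 b).
apply/MAX_GammaNS; exists (unzip1 b), (unzip1 (flat (b' :: bs))); split=> //.
  exact: IH.
by rewrite /unzip1 map_cat -/(unzip1 _) unzip1_shiftX.
Qed.

Lemma flatP n t : MAX (GammaN xi n.+1) (unzip1 t) ->
  exists bs, [/\ size bs = n.+1, blocks bs & t = flat bs].
Proof.
elim: n t => [|n IH] t.
  move=> /MAX_GammaN1[s ms /unzip1_oshift[b -> bs]].
  by exists [:: b]; rewrite /= bs cats0.
move=> /MAX_GammaNS[s [u [ms mu /unzip1_cat[t1 [t2 [-> /unzip1_oshift[b -> bE] t2E]]]]]].
have [|bs [bsn Hbs ->]] := IH t2; first by rewrite t2E.
by exists (b :: bs); rewrite /= bsn bE.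
Qed.

Lemma Omega_take zeta t j : Omega D zeta t -> (0 < j <= size t)%N -> Omega D zeta (take j t).
Proof.
move=> Gt /andP[j0 jt]; have [_ _ Gp _] := seqtree_Gamma zeta.
rewrite /Omega /labelled /= in Gt *.
apply: (Gp _ (unzip1 (drop j t))); first by rewrite /unzip1 -map_cat cat_take_drop.
by rewrite -size_eq0 size_map size_takel // -lt0n.
Qed.

(** The factor 1/n of P_{xi+1} on Omega_{xi,n} cancels against the number of blocks, leaving the sum
    of their P_xi-averages. *)
Lemma wsum_flat bs v : blocks bs ->
  (size bs)%:R * wsum (Pxi R (osucc xi)) (flat bs) v = blocksum bs v.
Proof.
rewrite -wsum_scale; elim: bs v => [|b bs IH] v /=; first by rewrite /wsum big_nil.
move=> [mb Hbs]; rewrite wsum_cat size_shiftX -IH //; congr (_ + _).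
  rewrite wsum_map; apply: eq_wsum => j jb /=; apply: Pxi_first.
  by apply: Omega_take jb; exact: mb.1.
apply: eq_wsum => j /andP[j0 jb]; apply: Pxi_rest => //.
have bs0 : bs <> [::] by move=> bs0; move: jb; rewrite bs0 /= leqn0 => /eqP j00; move: j0; rewrite j00.
have [n bsn] : exists n, size bs = n.+1 by case: (bs) bs0 => // c l _; exists (size l).
have := (MAX_flat bs0 Hbs).1; rewrite /OmegaN /labelled /= bsn => Gbs.
have [_ _ Gp _] := seqtree_GammaN n (seqtree_Gamma xi).
apply: (Gp _ (unzip1 (drop j (flat bs)))); first by rewrite /unzip1 -map_cat cat_take_drop.
by rewrite -size_eq0 size_map size_takel // -lt0n.
Qed.

End Blocks.

Section TotalWeight.
Context (R : realType) (D : Type).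
Local Notation X := (ordnum * D)%type.

Lemma wsum_shift_lim xi zeta (t : seq X) (v : nat -> R) :
  olimit xi -> (zeta < xi)%O -> Omega D (osucc zeta) t ->
  wsum (Pxi R xi) (shiftX (opow zeta) t) v = wsum (Pxi R (osucc zeta)) t v.
Proof.
move=> xil zx Gt; rewrite wsum_map; apply: eq_wsum => j jt.
by apply: Pxi_lim => //; exact: Omega_take.
Qed.

(** At a successor the total is the mean of the totals of the blocks, each 1 by induction; a limit
    step only shifts the branch. *)
Lemma wsum1 xi (t : seq X) :
  MAX (Gamma xi) (unzip1 t) -> wsum (Pxi R xi) t (fun=> 1) = 1.
Proof.
elim/(well_founded_ind olt_wf): xi t => xi IH t.
case: (ord_case xi) => [->|[zeta xiE]|xil].
- move=> /MAX_Gamma0; case: t => [|[x U] [|y t]] //= [->].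
  by rewrite /wsum big_nat1 /= Pxi_zero mulr1.
- move: IH; rewrite xiE => /(_ _ (lt_self_osucc zeta)) IH.
  move=> /MAX_GammaS[n /flatP[bs [bsn Hbs ->]]].
  have n0 : n.+1%:R != 0 :> R by rewrite pnatr_eq0.
  apply: (mulfI n0); rewrite mulr1 -{1}bsn wsum_flat // -{}bsn {n0 n}.
  elim: bs Hbs => //= b bs IHbs [/IH -> /IHbs ->].
  by rewrite -natr1 addrC.
- move=> /MAX_Gamma_lim => /(_ xil)[z [s [zx ms /unzip1_oshift[t' -> t'E]]]].
  rewrite wsum_shift_lim //; last by rewrite /Omega /labelled /= t'E; exact: ms.1.
  by apply: IH; [case: xil => _; apply|rewrite t'E].
Qed.

End TotalWeight.

(** * Selecting a colour *)

Section GoodBlocks.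
Context (R : realType) (d : Order.disp_t) (D : preorderType d).
Local Notation X := (ordnum * D)%type.
Implicit Types (t : seq X) (hs : seq (seq X)) (v : nat -> R) (J : nat -> bool).

(** This is what a history must satisfy for its strategy to serve as theta, with [t] as the value of
    e; [Q] tests lengths, as in [wsum]. *)
Definition good (Q : nat -> Prop) hs t : Prop :=
  pairwise (fun s s' => prefix s s' && (s != s')) hs /\
  forall s, s \in hs -> [/\ s != [::], prefix s t & Q (size s)].

Lemma good_imp (Q Q' : nat -> Prop) hs t : (forall j, (j <= size t)%N -> Q j -> Q' j) ->
  good Q hs t -> good Q' hs t.
Proof.
move=> QQ [sorted H]; split=> // s /H[s0 st Qs]; split=> //; apply: QQ => //.
exact: size_prefix.
Qed.

Lemma prefix_shiftX z (s t : seq X) : prefix (shiftX z s) (shiftX z t) = prefix s t.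
Proof.
apply/idP/idP => [/prefixP[u E]|/prefixP[u ->]]; last by rewrite /shiftX map_cat prefix_prefix.
apply/prefixP; exists (drop (size s) t).
rewrite -{1}(cat_take_drop (size s) t); congr (_ ++ _).
have inj : injective (fun x : X => (oadd z x.1, x.2)).
  by move=> [a b] [a' b'] [/oadd_inj -> ->].
apply: (inj_map inj); rewrite map_take -/(shiftX z t) E take_size_cat //.
exact: size_shiftX.
Qed.

Lemma shiftX_inj z : injective (@shiftX D z).
Proof. by apply: inj_map => -[a b] [a' b'] [/oadd_inj -> ->]. Qed.

Lemma good_shift z Q hs t : good Q hs t -> good Q (map (shiftX z) hs) (shiftX z t).
Proof.
move=> [sorted H]; split.
  rewrite pairwise_map; apply: sub_pairwise sorted => s s' /=.
  by rewrite prefix_shiftX (inj_eq (@shiftX_inj z)).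
move=> _ /mapP[s /H[s0 st Qs] ->]; split; rewrite ?prefix_shiftX ?size_shiftX //.
by case: (s) s0.
Qed.

Lemma prefix_cat2l (b s t : seq X) : prefix (b ++ s) (b ++ t) = prefix s t.
Proof. by rewrite prefix_catr // eqxx. Qed.

Lemma good_prepend Q hs t b :
  good (fun j => Q (size b + j)%N) hs t -> good Q (map (cat b) hs) (b ++ t).
Proof.
move=> [sorted H]; split.
  rewrite pairwise_map; apply: sub_pairwise sorted => s s' /=.
  by rewrite prefix_cat2l eqseq_cat // eqxx.
move=> _ /mapP[s /H[s0 st Qs] ->]; split; rewrite ?prefix_cat2l ?size_cat //.
by rewrite -size_eq0 size_cat addn_eq0 (size_eq0 s) (negPf s0) andbF.
Qed.

Lemma good_cat Q hs hs' b t : good Q hs b ->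
  good (fun j => Q (size b + j)%N) hs' t -> good Q (hs ++ map (cat b) hs') (b ++ t).
Proof.
move=> [sorted H] Gt; have [sorted' H'] := good_prepend Gt; split.
  rewrite pairwise_cat sorted sorted' !andbT; apply/allrelP => s y /H[s0 sb _].
  move=> /mapP[s' /(Gt.2)[s'0 _ _] ->]; apply/andP; split.
    exact: prefix_trans sb (prefix_prefix _ _).
  apply: contraTneq (size_prefix sb) => ->.
  by rewrite size_cat -ltnNge -[X in (X < _)%N]addn0 ltn_add2l lt0n size_eq0.
move=> s; rewrite mem_cat => /orP[/H[s0 sb Qs]|]; last exact: H'.
by split=> //; exact: prefix_trans sb (prefix_prefix _ _).
Qed.

Definition nblocks J m : nat := \sum_(j < m) J j.

Lemma nblocksS J m : nblocks J m.+1 = (nblocks J m + J m)%N.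
Proof. exact: big_ord_recr. Qed.

Lemma eq_nblocks J J' m : (forall j, (j < m)%N -> J j = J' j) -> nblocks J m = nblocks J' m.
Proof. by move=> E; apply: eq_bigr => j _; rewrite E. Qed.

(** Only the first [N] selected indices survive, counted upwards from 0. *)
Lemma nblocks_truncated J N m :
  nblocks (fun j => J j && (nblocks J j < N)%N) m = minn N (nblocks J m).
Proof.
elim: m => [|m IH]; first by rewrite /nblocks !big_ord0 minn0.
rewrite !nblocksS IH; case: (J m) => /=; last by rewrite !addn0.
rewrite addn1; case: ltnP => NJ; last by rewrite addn0 (minn_idPl (leqW NJ)).
by rewrite addn1 (minn_idPr NJ).
Qed.

(* The index of a block is the number of blocks after it, matching the shift by
   omega ^ xi times that number in the definition of Gamma_{xi,n}. *)
Fixpoint good_blocks xi J (bs : seq (seq X)) v : Prop :=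
  if bs is b :: bs' then
    (J (size bs') -> 0 <= wsum (Pxi R xi) b v) /\
    good_blocks xi J bs' (fun j => v (size b + j)%N)
  else True.

Lemma good_blocks_sub xi J J' bs v : (forall j, (j < size bs)%N -> J' j -> J j) ->
  good_blocks xi J bs v -> good_blocks xi J' bs v.
Proof.
elim: bs v => //= b bs IH v JJ [Jb Hbs]; split; first by move=> /JJ; rewrite ltnSn => /(_ isT).
by apply: IH Hbs => j jb; apply: JJ; exact: leq_trans jb (leqnSn _).
Qed.

(* Averages below -e contribute at most -e each, the others at most K each. *)
Lemma many_good_blocks xi bs v (K e : R) : 0 <= e -> (forall j, v j <= K) -> blocks xi bs ->
  exists J, good_blocks xi J bs (fun j => v j + e) /\
    blocksum xi bs v <= K * (nblocks J (size bs))%:R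
                          - e * ((size bs)%:R - (nblocks J (size bs))%:R).
Proof.
move=> e0; elim: bs v => [|b bs IH] v vK.
  by exists xpredT; split=> //=; rewrite /nblocks big_ord0 subrr !mulr0 subrr.
move=> [mb Hbs]; have [J [HJ sumJ]] := IH (fun j => v (size b + j)%N) (fun j => vK _) Hbs.
pose A := wsum (Pxi R xi) b v.
have AK : A <= K.
  rewrite -[leRHS]mulr1 -(wsum1 R mb) -wsum_cst; apply: ler_wsum => [s|j _] //.
  exact: Pxi_ge0.
(* The new first block has index [size bs]. It is selected when its average is at least [- e];
   adding [e] to the values then makes the average nonnegative, the total weight being 1. *)
pose J' j := if j == size bs then - e <= A else J j.
have JJ j : (j < size bs)%N -> J' j = J j by move=> jb; rewrite /J' (ltn_eqF jb).
exists J'; split.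
  split; last by apply: good_blocks_sub HJ => j /JJ ->.
  by rewrite /J' eqxx wsum_addc (wsum1 R mb) mulr1 -/A -lerBlDr sub0r.
have JE : J' (size bs) = (- e <= A) by rewrite /J' eqxx.
rewrite [size _]/= nblocksS (eq_nblocks JJ) JE natrD -natr1 [blocksum _ _ _]/=.
apply: le_trans (lerD (lexx A) sumJ) _.
by have [Ae|Ae] := leP (- e) A; rewrite /=; lra.
Qed.

End GoodBlocks.

Lemma dominates_shiftX (d : Order.disp_t) (D : preorderType d) z (U : D) y :
  dominates U y -> dominates U (shiftX z y).
Proof.
by case: y => //= a y; rewrite (last_map (fun x : ordnum * D => (oadd z x.1, x.2)) y a).
Qed.

Lemma dominates_cat (d : Order.disp_t) (D : preorderType d) b (U : D) y :
  dominates U y -> dominates U (b ++ y).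
Proof. by case: y => // a y; case: b => //= c b; rewrite last_cat. Qed.

(** * The induction on xi *)

Section Selection.
Context (R : realType) (d : Order.disp_t) (D : preorderType d).
Local Notation X := (ordnum * D)%type.
Implicit Types (t : seq X) (hs : seq (seq X)) (v : nat -> R) (J : nat -> bool).

(* v t j is the value attached to the prefix of length j of the maximal branch t. *)
Definition selective xi : Prop :=
  forall (C : finType) (chi : seq X -> C) (v : seq X -> nat -> R) (K e : R),
    0 < e -> (forall t j, `|v t j| <= K) ->
    (forall t, MAX (Gamma xi) (unzip1 t) -> 0 <= wsum (Pxi R xi) t (v t)) ->
    exists c, strategy (Gamma xi) (fun hs => exists t,
      [/\ MAX (Gamma xi) (unzip1 t), chi t = c & good (fun j => - e <= v t j) hs t]).

(** If no colour occurs above every label, each colour [c] has a label [U c] above which it does not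
    occur; a common upper bound of these finitely many labels then has no possible colour. *)
Lemma selective0 : directed D -> selective ozero.
Proof.
move=> [iD dirD] C chi v K e e0 _ avg; apply: contrapT => /forallNP nc.
have /choice [U HU] : forall c, exists U : D, forall V, (U <= V)%O ->
    chi [:: (ozero, V)] <> c.
  move=> c; apply: contrapT => /forallNP nU; apply: (nc c).
  have /choice [g Hg] : forall U, exists V, (U <= V)%O /\ chi [:: (ozero, V)] = c.
    move=> U; apply: contrapT => /forallNP nV; apply: (nU U) => V UV cV.
    by apply: (nV V).
  exists (fun s => if s is (x, U) :: _ then [:: (ozero, g U)] else [::]).
  move=> t /MAX_Gamma0; case: t => [|[x U] [|y t]] //= [xE].
  rewrite xE; split=> [[|z [|? s]] // y u [<-] _ /=|]; first exact: (Hg U).1.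
  exists [:: (ozero, g U)]; split.
  - by apply/MAX_Gamma0.
  - exact: (Hg U).2.
  split=> // s; rewrite inE => /eqP ->; split; rewrite /= ?eqxx //.
  have /avg : MAX (Gamma ozero) (unzip1 [:: (ozero, g U)]) by apply/MAX_Gamma0.
  rewrite /wsum big_nat1 /= Pxi_zero mul1r => v0; apply: le_trans v0.
  by rewrite oppr_le0 ltW.
have [W HW] : exists W, forall c, c \in enum C -> (U c <= W)%O.
  elim: (enum C) => [|c cs [W HW]]; first by case: iD => W; exists W.
  have [V [cV WV]] := dirD (U c) W; exists V => c'; rewrite inE => /orP[/eqP -> //|].
  by move=> /HW/le_trans; apply.
by apply: (HU (chi [:: (ozero, W)]) W) => //; apply: HW; rewrite mem_enum.
Qed.

(* Rounding up to multiples of e leaves finitely many values, which can be made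
   part of the colour. *)
Lemma rounding (K e : R) : 0 < e -> exists (L : nat) (r : R -> 'I_L.+1) (q : 'I_L.+1 -> R),
  [/\ forall x, `|x| <= K -> x <= q (r x), forall x, `|x| <= K -> q (r x) <= x + e
    & exists K', forall i, `|q i| <= K'].
Proof.
(* The interval from -K to K has length K + K, so its cells of length [e] have indices at most [L];
   the rounded value is the upper end of the cell. *)
move=> e0; pose L := Num.trunc ((K + K) / e).
pose idx (x : R) := Num.trunc ((x + K) / e).
exists L, (fun x => inord (idx x)), (fun i : 'I_L.+1 => (i : nat).+1%:R * e - K).
have idxE x : `|x| <= K -> (inord (idx x) : 'I_L.+1) = idx x :> nat /\
    (idx x)%:R * e <= x + K < (idx x).+1%:R * e.
  rewrite ler_norml => /andP[xK1 xK2].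
  have x0 : 0 <= (x + K) / e by rewrite divr_ge0 ?(ltW e0) //; lra.
  split; last by have := truncn_itv x0; rewrite ler_pdivlMr // ltr_pdivrMr.
  rewrite inordK // ltnS; apply: le_truncn; rewrite ler_pM2r ?invr_gt0 //; lra.
split=> [x /idxE[-> /andP[]]|x /idxE[-> /andP[]]|].
- by move=> _; rewrite lerBrDr => /ltW.
- by rewrite -natr1 mulrDl mul1r => lo _; lra.
- exists (L.+1%:R * e + `|K|) => i; apply: le_trans (ler_normB _ _) _; rewrite lerD2r.
  by rewrite ger0_norm ?mulr_ge0 ?(ltW e0) // ler_pM2r // ler_nat.
Qed.

(** Induction on the number of blocks, the first being split off. The colour says through [J] which
    blocks are known to have a nonnegative average; rounds are played on these, and the other blocks
    are filled in without a round. *)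
Lemma selective_blocks xi : inhabited D -> selective xi ->
  forall m (C : finType) (chi : seq (seq X) -> C) (J : C -> nat -> bool)
    (v : seq (seq X) -> nat -> R) (K e : R),
  0 < e -> (forall bs j, `|v bs j| <= K) ->
  (forall bs, size bs = m -> blocks xi bs -> good_blocks xi (J (chi bs)) bs (v bs)) ->
  exists c, strategies xi (nblocks (J c) m) (fun hs => exists bs,
    [/\ size bs = m, blocks xi bs, chi bs = c
      & good (fun j => - e <= v bs j) hs (flat xi bs)]).
Proof.
move=> iD sel; elim=> [|m IH] C chi J v K e e0 vK Hgood.
  exists (chi [::]); rewrite /nblocks big_ord0 /=; exists [::]; split=> //.
have e20 : 0 < e / 2 by lra.
have [L [r [q [rlo rhi [K' qK']]]]] := rounding K e20.
(* For a first block [t], [cw t] consists of a colour that the continuations can be made to have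
   and, if the block is selected, of upper approximations to their values on [t]. *)
have /choice [cw Hcw] : forall t, exists cw : C * (nat -> R),
    (forall j, `|cw.2 j| <= `|K'|) /\ (MAX (Gamma xi) (unzip1 t) ->
    0 <= wsum (Pxi R xi) t cw.2 /\
    strategies xi (nblocks (J cw.1) m) (fun hs => exists bs,
      [/\ size bs = m, blocks xi bs, chi (t :: bs) = cw.1,
          J cw.1 m -> forall j, (j <= size t)%N -> cw.2 j <= v (t :: bs) j + e / 2
        & good (fun j => - (e / 2) <= v (t :: bs) (size t + j)%N) hs (flat xi bs)])).
  move=> t; have [mt|nt] := pselect (MAX (Gamma xi) (unzip1 t)); last first.
    by exists (chi [::], fun=> 0); split=> // j; rewrite normr0.
  (* The colour of a continuation also records its rounded values at the lengths up to [size t]. *)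
  pose C' := (C * {ffun 'I_(size t).+1 -> 'I_L.+1})%type.
  pose chi' bs : C' := (chi (t :: bs), [ffun j : 'I__ => r (v (t :: bs) j)]).
  have [bs sbs Hbs|[c F] St] := IH C' chi' (fun c => J c.1)
      (fun bs j => v (t :: bs) (size t + j)%N) K (e / 2) e20 (fun bs j => vK _ _).
    by have [] := Hgood (t :: bs) (congr1 S sbs) (conj mt Hbs).
  have near bs : chi' bs = (c, F) -> forall j, (j <= size t)%N ->
      v (t :: bs) j <= q (F (inord j)) <= v (t :: bs) j + e / 2.
    by move=> [_ <-] j jt; rewrite ffunE inordK // rlo ?rhi.
  have [Jc|nJc] := boolP (J c m); last first.
    (* No average is known for an unselected first block; the values 0 have a nonnegative one. *)
    exists (c, fun=> 0); split=> [j|_ /=]; first by rewrite normr0.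
    split; first by rewrite wsum_cst mul0r.
    apply: (@strategies_map _ _ _ _ _ _ id) St => // hs [bs [sbs Hbs E G]].
    rewrite map_id; exists bs; split=> //; first by case: E.
    by rewrite (negPf nJc).
  exists (c, fun j => q (F (inord j))); split=> [j|_ /=].
    exact: le_trans (qK' _) (ler_norm _).
  split.
    (* One continuation suffices: the rounded values are at least its own values on [t], whose
       average is nonnegative. *)
    have [hs [bs [sbs Hbs E _]]] := strategies_ex iD St.
    have [] := Hgood (t :: bs) (congr1 S sbs) (conj mt Hbs).
    have -> : chi (t :: bs) = c by case: E.
    rewrite sbs => /(_ Jc) avg _; apply: le_trans avg _; apply: ler_wsum => [s|j jt].
      exact: Pxi_ge0.
    by have /andP[] := near _ E j jt.
  apply: (@strategies_map _ _ _ _ _ _ id) St => // hs [bs [sbs Hbs E G]].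
  rewrite map_id; exists bs; split=> //; first by case: E.
  by move=> _ j jt; have /andP[] := near _ E j jt.
have [c S] := sel C (fun t => (cw t).1) (fun t => (cw t).2) `|K'| (e / 2) e20
  (fun t => (Hcw t).1) (fun t mt => ((Hcw t).2 mt).1).
pose z := omuln (opow xi) m.
exists c; rewrite nblocksS; have [Jc|nJc] := boolP (J c m); last first.
  (* The first block is not selected: a single block [t] is put in front of all later rounds. *)
  rewrite addn0; have [hs [t [mt tc G]]] := strategy_ex iD (seqtree_Gamma xi) S.
  have [_] := (Hcw t).2 mt; rewrite tc.
  apply: (@strategies_map _ _ _ _ _ _ (cat (shiftX z t))) => [U y|hs' [bs [sbs Hbs E _ G']]].
    exact: dominates_cat.
  exists (t :: bs); split=> //=; rewrite ?sbs //; apply: good_prepend.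
  by apply: good_imp G' => j _; rewrite size_shiftX; lra.
(* The first block is selected, and [S] plays its round. An error e/2 from [S] and an error e/2 from
   the rounding add up to [e]. *)
rewrite addn1; apply: (@strategy_map _ _ _ _ _ (shiftX z)) S => [U y|hs [t [mt tc G]]].
  exact: dominates_shiftX.
have [_] := (Hcw t).2 mt; rewrite tc.
apply: (@strategies_map _ _ _ _ _ _ (cat (shiftX z t))) => [U y|hs' [bs [sbs Hbs E near G']]].
  exact: dominates_cat.
exists (t :: bs); split=> //=; rewrite ?sbs //; apply: good_cat.
  by apply: good_shift; apply: good_imp G => j /(near Jc); lra.
by apply: good_imp G' => j _; rewrite size_shiftX; lra.
Qed.

(** By contradiction: each colour [c] fails on Gamma_{xi,n} for some n = [(N c).+1]. With so many
    blocks that every branch has enough good ones, the colour can record exactly [(N c).+1] of them,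
    and [selective_blocks] yields a strategy for that many rounds. *)
Lemma selectiveS xi : inhabited D -> selective xi -> selective (osucc xi).
Proof.
move=> iD sel C chi v K e e0 vK avg; apply: contrapT => /forallNP nc.
have /choice [N HN] : forall c, exists n, ~ strategy (GammaN xi n.+1) (fun hs => exists t,
    [/\ MAX (Gamma (osucc xi)) (unzip1 t), chi t = c & good (fun j => - e <= v t j) hs t]).
  move=> c; apply: contrapT => /forallNP Hn; apply: (nc c); apply: strategy_GammaS => n.
  exact: contrapT (Hn n).
pose M := \max_c (N c).+1.
have e20 : 0 < e / 2 by lra.
have K0 : 0 <= K by apply: le_trans (vK [::] 0%N).
(* With at most [M] good blocks among [m], the block sum would be at most M (K + e/2) - m e/2, which
   is negative. *)
pose m := (Num.trunc (M%:R * (K + e / 2) / (e / 2))).+1.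
have mM : M%:R * (K + e / 2) < m%:R * (e / 2) by rewrite -ltr_pdivrMr // truncnS_gt.
have flat_MAX bs : size bs = m -> blocks xi bs -> MAX (Gamma (osucc xi)) (unzip1 (flat xi bs)).
  move=> sbs Hbs; apply/MAX_GammaS; exists m.-1; rewrite /= -/m -sbs.
  by apply: MAX_flat => // bs0; move: sbs; rewrite bs0.
have /choice [G HG] : forall bs, exists J, size bs = m -> blocks xi bs ->
    good_blocks xi J bs (fun j => v (flat xi bs) j + e / 2) /\ (M <= nblocks J m)%N.
  move=> bs; have [[sbs Hbs]|nbs] := pselect (size bs = m /\ blocks xi bs); last first.
    by exists xpredT => sbs Hbs; case: nbs.
  have [J [HJ sumJ]] := many_good_blocks (ltW e20) (fun j => le_trans (ler_norm _) (vK (flat xi bs) j)) Hbs.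
  exists J => _ _; split=> //; rewrite -ltnS -(ltr_nat R) -natr1.
  have sum0 : 0 <= blocksum xi bs (v (flat xi bs)).
    by rewrite -wsum_flat // mulr_ge0 // avg //; exact: flat_MAX.
  move: sumJ; rewrite sbs => sumJ.
  have Ke : 0 < K + e / 2 by lra.
  suff : M%:R < (nblocks J m)%:R :> R by lra.
  by rewrite -(ltr_pM2r Ke); lra.
pose C' := (C * {ffun 'I_m.+1 -> bool})%type.
(* Keeping only the first [n] selected indices makes the number of rounds a function of the colour
   of the branch. *)
pose trim (J : nat -> bool) n j := J j && (nblocks J j < n)%N.
pose chi' bs : C' := (chi (flat xi bs), [ffun j : 'I__ => trim (G bs) (N (chi (flat xi bs))).+1 j]).
pose J' (c : C') j := c.2 (inord j).
have JE bs j : (j < m)%N -> J' (chi' bs) j = trim (G bs) (N (chi (flat xi bs))).+1 j.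
  by move=> jm; rewrite /J' ffunE inordK // (leq_trans jm).
have [||c S] := selective_blocks iD sel (m := m) (chi := chi') (J := J')
    (v := fun bs j => v (flat xi bs) j + e / 2) (K := K + e / 2) e20.
- move=> bs j; apply: le_trans (ler_normD _ _) _.
  by rewrite (ger0_norm (ltW e20)) lerD2r.
- move=> bs sbs Hbs; apply: good_blocks_sub (HG bs sbs Hbs).1 => j.
  by rewrite sbs => /JE -> /andP[].
(* A branch that realises [c] shows how many indices the selection recorded in [c] has. *)
have [hs [bs [sbs Hbs cE _]]] := strategies_ex iD S.
apply: (HN c.1); apply: strategies_GammaN.
have cnt : nblocks (J' c) m = (N c.1).+1.
  rewrite -cE (eq_nblocks (JE bs)) nblocks_truncated; apply/minn_idPl.
  apply: leq_trans (HG bs sbs Hbs).2; exact: (leq_bigmax (F := fun c => (N c).+1)).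
move: S; rewrite cnt; apply: (@strategies_map _ _ _ _ _ _ id) => // hs' [bs' [sbs' Hbs' E Gd]].
rewrite map_id; exists (flat xi bs'); split; first exact: flat_MAX.
  by rewrite -E.
by apply: good_imp Gd => j _; lra.
Qed.

(** By contradiction: each colour [c] fails on Gamma_{zeta+1} for some zeta = [N c]. The hypothesis
    at the largest of these finitely many ordinals gives a colour and a strategy, which restricts to
    the smaller tree belonging to that colour. *)
Lemma selective_lim xi : olimit xi ->
  (forall zeta, (zeta < xi)%O -> selective (osucc zeta)) -> selective xi.
Proof.
move=> xil sel C chi v K e e0 vK avg; apply: contrapT => /forallNP nc.
have /choice [N HN] : forall c, exists zeta, (zeta < xi)%O /\
    ~ strategy (Gamma (osucc zeta)) (fun hs => exists t,
    [/\ MAX (Gamma xi) (unzip1 t), chi t = c & good (fun j => - e <= v t j) hs t]).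
  move=> c; apply: contrapT => /forallNP Hn; apply: (nc c).
  apply: strategy_Gamma_lim => // z zx; apply: contrapT => nS; by apply: (Hn z).
pose z := (\big[Order.max/ozero]_c N c)%O.
have zx : (z < xi)%O by apply: bigmax_lt => [|c _]; [case: xil|exact: (HN c).1].
have up t : MAX (Gamma (osucc z)) (unzip1 t) -> MAX (Gamma xi) (unzip1 (shiftX (opow z) t)).
  by move=> mt; apply/MAX_Gamma_lim => //; exists z, (unzip1 t); rewrite unzip1_shiftX.
have [||c S] := sel z zx C (chi \o shiftX (opow z)) (v \o shiftX (opow z)) K e e0.
- by move=> t j; exact: vK.
- move=> t mt; rewrite -(wsum_shift_lim _ xil zx) //; last exact: mt.1.
  exact/avg/up.
apply: (HN c).2; apply: (@strategy_Gamma_mono _ _ _ (osucc z)).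
  by apply: osucc_le; apply/lt_osucc; exact: (le_bigmax ozero N c).
apply: (@strategy_map _ _ _ _ _ (shiftX (opow z))) S => [U y|hs [t [mt tc G]]]; first exact: dominates_shiftX.
exists (shiftX (opow z) t); split=> //; first exact: up.
exact: good_shift.
Qed.

Lemma selective_all xi : directed D -> selective xi.
Proof.
move=> dirD; have iD := dirD.1; elim/(well_founded_ind olt_wf): xi => xi IH.
case: (ord_case xi) => [->|[zeta xiE]|xil].
- exact: selective0.
- rewrite xiE; apply: selectiveS => //; apply: IH; rewrite xiE; exact: lt_self_osucc.
- by apply: selective_lim => // z /xil.2; exact: IH.
Qed.

End Selection.

(** * From strategies to extended prunings, and the theorem *)

Lemma sum_initsegs (R : realType) (D : choiceType) xi (t : seq (ordnum * D))
    (p g : seq (ordnum * D) -> R) : Omega D xi t ->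
  \sum_(s <- initsegs t | s \in Omega D xi) p s * g s = wsum p t (fun j => g (take j t)).
Proof.
move=> Gt; rewrite /initsegs big_map /= big_cons take0.
have -> : ([::] \in Omega D xi) = false by apply/negP => /set_mem/Gamma_nil.
rewrite (iotaDl 1 0) big_map /wsum /index_iota subn0 big_seq_cond [RHS]big_seq.
apply: eq_bigl => j; rewrite mem_iota add0n add1n /=; case: ltnP => //= jt.
by apply/mem_set/Omega_take.
Qed.

Section FromStrategy.
Context (R : realType) (d : Order.disp_t) (D : preorderType d) (xi : ordnum).
Local Notation X := (ordnum * D)%type.

(** The strategy itself is theta, and e(t) is the witness for the history along [t]. Every member of
    Omega_xi lies on a maximal branch, where the conditions on the strategy give the clauses of a
    pruning. *)
Lemma extended_pruning_of_strategy (B : seq X -> nat -> Prop) : inhabited D ->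
  strategy (Gamma xi) (fun hs => exists t, MAX (Gamma xi) (unzip1 t) /\ good (B t) hs t) ->
  exists theta e, @extended_pruning d D xi theta e /\
    forall s t, PiS (Omega D xi) (s, t) -> prefix (theta s) (e t) /\ B (e t) (size (theta s)).
Proof.
move=> iD [h H].
have /choice [e He] : forall t : seq X, exists t' : seq X, MAX (Gamma xi) (unzip1 t) ->
    MAX (Gamma xi) (unzip1 t') /\ good (B t') (history h t) t'.
  move=> t; have [/H[_ [t' Ht']]|nt] := pselect (MAX (Gamma xi) (unzip1 t)); last by exists t.
  by exists t'.
have split_last (s : seq X) u : Omega D xi s -> exists s' x,
    s = rcons s' x /\ history h (s ++ u) = rcons (history h s') (h s) ++ history (fun y => h (s ++ y)) u.
  case/lastP: s => [/Gamma_nil//|s x] _; exists s, x; split=> //.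
  by rewrite history_cat history_rcons.
have above s : Omega D xi s -> exists u, MAX (Omega D xi) (s ++ u).
  move=> Gs; have [_ _ _ Ge] := seqtree_Gamma xi; have [u mu] := Ge _ Gs.
  case: iD => U0; exists [seq (x, U0) | x <- u]; apply/MAX_labelled; first by split.
  by rewrite /unzip1 map_cat -map_comp map_id.
have branch s u : Omega D xi s -> MAX (Omega D xi) (s ++ u) ->
    [/\ h s != [::], prefix (h s) (e (s ++ u)) & B (e (s ++ u)) (size (h s))].
  move=> Gs /(MAX_labelled _ _ iD)/He[_ [_ G]]; apply: G.
  by have [s' [x [_ ->]]] := split_last s u Gs; rewrite mem_cat mem_rcons mem_head.
have maxe t : MAX (Omega D xi) t -> MAX (Omega D xi) (e t).
  by move=> /(MAX_labelled _ _ iD)/He[me _]; apply/MAX_labelled.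
exists h, e; split; last first.
  by move=> s t [/= Gs Gt /prefixP[u ->] mt]; have [] := branch s u Gs mt.
split=> //; last first.
  move=> t mt; have [] := branch t [::] mt.1; rewrite cats0 => //.
split.
- move=> s Gs; have [u mu] := above s Gs; have [h0 /prefixP[w eE] _] := branch s u Gs mu.
  have := (maxe _ mu).1; rewrite eE => Gh.
  have [_ _ Gp _] := seqtree_Gamma xi; apply: (Gp _ (unzip1 w)).
    by rewrite /unzip1 -map_cat.
  by rewrite -size_eq0 size_map size_eq0.
(* [h s] and [h t] occur in this order in the history along one maximal branch, which is strictly
   increasing. *)
- move=> s t Gs Gt /andP[/prefixP[u tE] st].
  have [w mw] := above t Gt; have [_ [sorted _]] := He _ ((MAX_labelled _ _ iD).1 mw).
  have [s' [x [_ E]]] := split_last s (u ++ w) Gs.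
  move: sorted; rewrite tE -catA E pairwise_cat => /andP[/allrelP rel _].
  apply: (rel (h s) (h (s ++ u))); first by rewrite mem_rcons mem_head.
  have : u != [::] by apply: contraNneq st => u0; rewrite tE u0 cats0.
  case/lastP: (u) => // u' y _; rewrite history_cat history_rcons.
  by rewrite mem_cat mem_rcons mem_head.
- move=> s s1 s2 z U z' U' Gs sE hE; have [w mw] := above s Gs.
  have [dom _] := H _ ((MAX_labelled _ _ iD).1 mw).
  have := dom s1 (z, U) w; rewrite -sE => /(_ erefl); rewrite hE.
  by case: (s2) => //= a s3; rewrite last_rcons.
Qed.

End FromStrategy.

Theorem theorem5p1 (R : realType) (d : Order.disp_t) (D : preorderType d)
    (hD : directed D) (xi : ordnum) (n : nat) (hn : (0 < n)%N)
    (F : 'I_n -> set (seq (ordnum * D) * seq (ordnum * D) -> R))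
    (hF : forall (i : 'I_n) (f : seq (ordnum * D) * seq (ordnum * D) -> R),
        F i f -> [bounded f p | p in PiS (Omega D xi)])
    (eps : 'I_n -> R)
    (hlarge : forall (i : 'I_n) (f : seq (ordnum * D) * seq (ordnum * D) -> R),
        F i f -> ~ large xi f (eps i))
    (f : 'I_n -> seq (ordnum * D) * seq (ordnum * D) -> R)
    (hf : forall i : 'I_n, F i (f i)) :
  (ereal_inf
     [set \big[maxe/-oo]_(i < n)
            (\sum_(s <- initsegs t | s \in Omega D xi) Pxi R xi s * f i (s, t)
             - eps i)%:E
     | t in MAX (Omega D xi)] <= 0)%E.
Proof.
have iD := hD.1; rewrite leNgt; apply/negP => inf_gt0.
have pos t : MAX (Omega D xi) t -> exists i, 0 <=
    \sum_(s <- initsegs t | s \in Omega D xi) Pxi R xi s * f i (s, t) - eps i.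
  move=> mt; apply: contrapT => /forallNP neg.
  have := lt_le_trans inf_gt0 (ereal_inf_lbound (imageP _ mt)).
  rewrite ltNge => /negP; apply; apply: (big_ind (fun x => (x <= 0)%E)).
  - exact: leNye.
  - by move=> x y x0 y0; rewrite ge_max x0 y0.
  - by move=> i _; rewrite lee_fin leNgt; apply/negP => /ltW; exact: neg.
have /choice [chi Hchi] : forall t, exists i : 'I_n, MAX (Omega D xi) t -> 0 <=
    \sum_(s <- initsegs t | s \in Omega D xi) Pxi R xi s * f i (s, t) - eps i.
  move=> t; have [/pos[i Hi]|nt] := pselect (MAX (Omega D xi) t); first by exists i.
  by exists (Ordinal hn).
have /choice [K HK] : forall i, exists K, forall p, PiS (Omega D xi) p -> `|f i p| <= K.
  move=> i; have [M [_ HM]] := hF i (f i) (hf i).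
  (* Boundedness provides as a bound every number strictly above [M]. *)
  by exists (M + 1) => p Hp; apply: HM Hp; rewrite ltrDl.
have /choice [delta Hdelta] : forall i, exists delta : R, 0 < delta /\
    ~ exists theta e, extended_pruning xi theta e /\
      forall s t, PiS (Omega D xi) (s, t) -> f i (theta s, e t) >= eps i - delta.
  move=> i; apply: contrapT => /forallNP Hi; apply: (hlarge i (f i) (hf i)) => delta d0.
  by apply: contrapT => nd; apply: (Hi delta).
(* One tolerance, at most every [delta i], serves whichever colour is found. *)
pose e := \big[Order.min/(1 : R)]_i delta i.
have e0 : 0 < e by apply/bigmin_gtP; split=> // i _; exact: (Hdelta i).1.
(* The functions are bounded only on Pi Omega_xi, so the value 0 is used elsewhere. *)
pose v t j := if `[< PiS (Omega D xi) (take j t, t) >]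
  then f (chi t) (take j t, t) - eps (chi t) else 0.
have vK t j : `|v t j| <= \sum_i (`|K i| + `|eps i|).
  rewrite /v; case: asboolP => Pi; last by rewrite normr0 sumr_ge0 // => i _; rewrite addr_ge0.
  rewrite (bigD1 (chi t)) //=; apply: le_trans (ler_normB _ _) _.
  rewrite -[leLHS]addr0; apply: lerD; last by apply: sumr_ge0 => i _; rewrite addr_ge0.
  by rewrite lerD2r (le_trans (HK _ _ Pi)) // ler_norm.
have [|c S] := @selective_all R d D xi hD 'I_n chi v _ _ e0 vK.
  move=> t mt; have Mt : MAX (Omega D xi) t by apply/MAX_labelled.
  apply: le_trans (Hchi t Mt) _.
  rewrite (@sum_initsegs R D xi t _ (fun s => f (chi t) (s, t))); last exact: Mt.1.
  (* The weights along [t] add up to 1, so [eps] can be moved inside the average. *)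
  rewrite -[eps _]mulr1 -(wsum1 R mt) -mulNr -wsum_addc; apply: ler_sum_nat => j /andP[_ jt].
  rewrite /v asboolT //; split=> //=; [|exact: Mt.1|exact: prefix_take].
  by apply: Omega_take => //; exact: Mt.1.
apply: (Hdelta c).2.
have [|theta [e' [ext H]]] := @extended_pruning_of_strategy d D xi
    (fun t j => chi t = c /\ - e <= v t j) iD.
  apply: strategy_imp S => hs [t [mt tc G]]; exists t; split=> //.
  by apply: good_imp G => j _.
exists theta, e'; split=> // s t st; have [pre [cE]] := H s t st.
have [[Gth _ _] maxe _] := ext; case: st => /= Gs Gt _ mt.
have thE : take (size (theta s)) (e' t) = theta s.
  by move/prefixP: pre => [w ->]; rewrite take_size_cat.
rewrite /v thE asboolT; last first.
  by split=> //=; [exact: Gth|exact: (maxe t mt).1|exact: maxe].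
rewrite cE lerBrDl => le; apply: le_trans le; rewrite lerD2l lerN2.
exact: bigmin_le.
Qed.
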